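(* Let $X$ be a nonempty compact metric space, let $f:X\to X$ be a continuous map, and suppose that $(X,f)$ has the approximate product property. Then $(X,f)$ is uniquely ergodic (i.e. it has exactly one $f$-invariant Borel probability measure) if and only if the topological entropy of $(X,f)$ is zero.
   Context: A system $(X,f)$ is a compact metric space $(X,d)$ with a continuous map $f:X\to X$ (not necessarily invertible). $\mathbb{Z}^+$ denotes the set of positive integers, and $\mathbb{Z}_n:=\{0,1,\dots,n-1\}$ for $n\in\mathbb{Z}^+$. Tracing. Let $\mathscr{C}=\{x_k\}_{k\in\mathbb{Z}^+}$ be a sequence in $X$ and let $\mathscr{S}=\{m_k\}_{k\in\mathbb{Z}^+}$, $\mathscr{G}=\{t_k\}_{k\in\mathbb{Z}^+}$ be sequences of positive integers. Put $s_1:=0$ and $s_k:=\sum_{i=1}^{k-1}(m_i+t_i-1)$ for $k\ge 2$. For real $\delta\ge 0$, $\varepsilon>0$ and $z\in X$, the triple $(\mathscr{C},\mathscr{S},\mathscr{G})$ is $(\delta,\varepsilon)$-traced by $z$ if for every $k\in\mathbb{Z}^+$, $$\left|\left\{j\in\mathbb{Z}_{m_k}: d(f^{s_k+j}(z),f^j(x_k))>\varepsilon\right\}\right|\le \delta m_k.$$ Approximate product property. $(X,f)$ has the approximate product property if for all $\delta_1,\delta_2,\varepsilon>0$ there is $M=M(\delta_1,\delta_2,\varepsilon)>0$ such that for every integer $n>M$ and every sequence $\mathscr{C}$ in $X$ there are a sequence $\mathscr{G}=\{t_k\}_{k\in\mathbb{Z}^+}$ of positive integers with $t_k\le 1+\delta_1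 n$ for all $k$ and a point $z\in X$ such that $(\mathscr{C},\{n\}^{\mathbb{Z}^+},\mathscr{G})$ is $(\delta_2,\varepsilon)$-traced by $z$, where $\{n\}^{\mathbb{Z}^+}$ is the constant sequence $n$. *)

(* Defs.v *)
From HB Require Import structures.
From mathcomp Require Import all_boot all_order all_algebra.
From mathcomp Require Import finmap.
From mathcomp Require Import all_classical all_reals all_analysis.

Set Implicit Arguments.
Unset Strict Implicit.
Unset Printing Implicit Defensive.

Import Order.TTheory GRing.Theory Num.Theory.
Import numFieldNormedType.Exports.

Local Open Scope classical_set_scope.
Local Open Scope ring_scope.

(* Nonempty metric spaces. The base point plays no role beyond witnessing
   nonemptiness; the library's measurable types are all pointed. *)
#[short(type="pmetricType")]
HB.structure Definition PointedMetric (R : numDomainType) :=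
  {X of Pointed X & Metric R X}.

Section approximate_product_property.
Context {R : realType} {X : metricType R}.
Implicit Types (f : X -> X) (x : nat -> X) (m t : nat -> nat).

(* Sequences indexed by the positive integers are shifted to start at index 0,
   so [trace_start m t k] is s_(k+1). The truncated subtraction is harmless
   because the entries of [m] and [t] are positive wherever this is used. *)
Definition trace_start m t (k : nat) : nat := (\sum_(i < k) (m i + t i - 1))%N.

Definition traced f x m t (delta eps : R) (z : X) : Prop :=
  forall k : nat,
    #|[pred j : 'I_(m k) |
        eps < mdist (iter (trace_start m t k + j)%N f z) (iter j f (x k))]|%:R
      <= delta * (m k)%:R.

Definition approximate_product_property f : Prop :=
  forall delta1 delta2 eps : R, 0 < delta1 -> 0 < delta2 -> 0 < eps ->
  exists2 M : R, 0 < M &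
  forall n : nat, M < n%:R ->
  forall x : nat -> X,
  exists t : nat -> nat,
    (forall k, (0 < t k)%N /\ (t k)%:R <= 1 + delta1 * n%:R) /\
    exists z : X, traced f x (fun=> n) t delta2 eps z.

End approximate_product_property.

Section topological_entropy.
Context {R : realType} {X : metricType R}.
Implicit Types (f : X -> X) (n : nat) (eps : R).

Definition bowen_separated f n eps (E : {fset X}) : Prop :=
  forall x y, x \in E -> y \in E -> x != y ->
  exists2 k : nat, (k < n)%N & eps < mdist (iter k f x) (iter k f y).

Definition max_separated f n eps : \bar R :=
  ereal_sup [set (#|` E|%:R)%:E | E in bowen_separated f n eps].

Definition entropy_at_scale f eps : \bar R :=
  limn_esup (fun n => (n%:R^-1)%:E * lne (max_separated f n eps))%E.

Lemma entropy_at_scale_nonincreasing f : nonincreasing_fun (entropy_at_scale f).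
Proof.
move=> e1 e2 e12; rewrite /entropy_at_scale !limn_esup_lim.
apply: lee_lim; [exact: is_cvg_esups|exact: is_cvg_esups|].
apply: nearW => n; apply: ge_ereal_sup => _ [k nk <-].
apply: le_trans (ereal_sup_ubound _); last by exists k.
have sep0 e : max_separated f k e \in `[0%E, +oo%E].
  rewrite in_itv/= leey andbT; apply: ereal_sup_ubound.
  by exists fset0 => //; rewrite cardfs0.
apply: lee_wpmul2l; first by rewrite lee_fin invr_ge0.
rewrite lee_lne//; apply: ereal_sup_le => _ [E sepE <-]; exists E => // x y xE yE.
by move=> /(sepE x y xE yE)[j jk ej]; exists j => //; exact: le_lt_trans ej.
Qed.

Lemma is_cvg_entropy_at_scale f : cvg (entropy_at_scale f eps @[eps --> 0^'+]).
Proof.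
apply: nonincreasing_at_right_is_cvge; apply: nearW => e x y _ _.
exact: entropy_at_scale_nonincreasing.
Qed.

(* Bowen's definition. The limit exists in [\bar R], since [entropy_at_scale f]
   is nonincreasing; see [is_cvg_entropy_at_scale]. *)
Definition topological_entropy f : \bar R :=
  lim (entropy_at_scale f eps @[eps --> 0^'+]).

End topological_entropy.

Section unique_ergodicity.
Context {R : realType} {X : pmetricType R}.

Local Notation borel := (g_sigma_algebraType (@open X)).

Definition invariant_measure (f : X -> X) (mu : probability borel R) : Prop :=
  forall A : set borel, measurable A -> mu (f @^-1` A) = mu A.

(* Library measures are total functions on sets, unconstrained outside the
   sigma-algebra; hence uniqueness is stated on Borel sets only. *)
Definition uniquely_ergodic (f : X -> X) : Prop :=
  exists2 mu : probability borel R, invariant_measure f mu &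
  forall nu : probability borel R, invariant_measure f nu ->
  forall A : set borel, measurable A -> nu A = mu A.

End unique_ergodicity.

(* Main.v *)
Require Import Defs.
From HB Require Import structures.
From mathcomp Require Import all_boot all_order all_algebra.
From mathcomp Require Import finmap.
From mathcomp Require Import all_classical all_reals all_analysis.
From mathcomp Require Import measurable_realfun.
From mathcomp Require Import ring lra zify.

(* Suppose that two invariant probabilities differ, hence [mu F > nu (F^r)] for
   some closed [F] and some metric neighborhood [F^r]. Integrating the number of
   visits yields, for every [n], an orbit segment of length [n] visiting [F]
   often and another one visiting [F^r] rarely. Trace all [2 ^ (2 L)]
   concatenations of [2 L] such segments. The starting times drift by the gaps,
   but recording the drift up to a small proportion of [n] costs only one bit
   per two segments, so [2 ^ L] of the concatenations have about the same
   drifts. The points tracing these are separated, and the entropy is positive.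

   Conversely, suppose that there is only one invariant probability. A point
   tracing one segment of length [n] again and again has only polynomially many
   windows of length [n], up to a small proportion of mismatches. By weak limits
   of empirical measures and unique ergodicity, any orbit shows one of these
   windows at almost all times, so its first [N] steps are determined, up to
   [e], by a phase modulo [n], a window for each block of length [n], and a
   sparse function recording the exceptions. The number of such codes grows at
   an arbitrarily small exponential rate. *)

Set Implicit Arguments.
Unset Strict Implicit.
Unset Printing Implicit Defensive.

Import Order.TTheory GRing.Theory Num.Theory.
Import numFieldNormedType.Exports.

Local Open Scope classical_set_scope.
Local Open Scope ring_scope.

(** * Limits of empirical measures *)

Definition visits T (f : T -> T) (A : set T) (n : nat) (x : T) : nat :=
  (\sum_(j < n) (iter j f x \in A))%N.

Section visits.
Context {T : Type} (f : T -> T).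
Implicit Types (A B : set T) (n : nat) (x : T).

Lemma visits_leq A n x : (visits f A n x <= n)%N.
Proof.
rewrite -[leqRHS]card_ord -sum1_card; apply: leq_sum => j _.
by case: (_ \in _).
Qed.

Lemma visitsT n x : visits f setT n x = n.
Proof.
rewrite /visits -[RHS]card_ord -sum1_card; apply: eq_bigr => j _.
by rewrite in_setT.
Qed.

Lemma visitsU A B n x : A `&` B = set0 ->
  visits f (A `|` B) n x = (visits f A n x + visits f B n x)%N.
Proof.
move=> AB0; rewrite /visits -big_split; apply: eq_bigr => j _ /=.
rewrite in_setU; case: (boolP (_ \in A)) => // /set_mem jA.
case: (boolP (_ \in B)) => // /set_mem jB.
by have : (A `&` B) (iter j f x) by []; rewrite AB0.
Qed.

(** Both sides count the visits to [A] at times 0 to [n]. So the counts for [A] and for its preimage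
    differ by at most one, whence invariance in the limit. *)
Lemma visits_preimage A n x :
  ((iter 0 f x \in A) + visits f (f @^-1` A) n x =
  visits f A n x + (iter n f x \in A))%N.
Proof.
transitivity (\sum_(j < n.+1) (iter j f x \in A))%N; last by rewrite big_ord_recr.
by rewrite big_ord_recl; congr (_ + _)%N; apply: eq_bigr => j _.
Qed.

End visits.

(** A cluster point in the compact segment is a limit, since an ultrafilter contains each set or its
    complement. *)
Lemma ultra_is_cvg {R : realType} I (G : set_system I) (a b : R) (u : I -> R) :
  UltraFilter G -> (forall i, a <= u i <= b) -> cvg (u @ G).
Proof.
move=> UG uab.
have PG : ProperFilter G by exact: ultra_proper.
have : (u @ G) [set` `[a, b]].
  by apply: (@filterE _ G) => i; rewrite /= in_itv; exact: uab.
move=> /(@segment_compact R a b _ _)[p [_ clp]]; apply/cvg_ex; exists p => U Up.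
case: (in_ultra_setVsetC (u @^-1` U) UG) => // GU.
by case: (clp (~` U) U) => // x [].
Qed.

Section limit_frequency.
Context {R : realType} {T : Type}.
Variables (f : T -> T) (y : nat -> T) (N : nat -> nat).
Hypothesis N_gt : forall i, (i < N i)%N.

(** Limits along one free ultrafilter exist for all subsets at once and preserve finite additivity
    and inequalities; [i < N i] makes the boundary term, at most [1 / N i], vanish. *)
Lemma limit_frequency : exists nu : set T -> R,
  [/\ (forall A, 0 <= nu A), nu setT = 1,
      (forall A B, A `&` B = set0 -> nu (A `|` B) = nu A + nu B),
      (forall A, nu (f @^-1` A) = nu A) &
      forall A (c : R),
        (forall i, (visits f A (N i) (y i))%:R <= c * (N i)%:R) -> nu A <= c].
Proof.
have [G [UG ooG]] := ultraFilterLemma eventually_filter.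
have PG : ProperFilter G by exact: ultra_proper.
pose u A i : R := (visits f A (N i) (y i))%:R / (N i)%:R.
have N0 i : 0 < (N i)%:R :> R by rewrite ltr0n (leq_ltn_trans _ (N_gt i)).
have u01 A i : 0 <= u A i <= 1.
  by rewrite divr_ge0//= ler_pdivrMr// mul1r ler_nat visits_leq.
have cu A : cvg (u A @ G) by exact: ultra_is_cvg (u01 A).
exists (fun A => lim (u A @ G)); split.
- by move=> A; apply: limr_ge => //; apply: nearW => i; case/andP: (u01 A i).
- rewrite (_ : u setT = cst 1) ?lim_cst//; apply/funext => i.
  by rewrite /u visitsT divff// gt_eqF.
- move=> A B AB0; rewrite -limD//; congr (lim (_ @ G)); apply/funext => i.
  by rewrite /u visitsU// natrD mulrDl.
- move=> A; apply/eqP; rewrite -subr_eq0 -limB//; apply/eqP/cvg_lim => //.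
  apply/cvgrPdist_le => e e0; apply: ooG.
  have le1 i : `|(visits f (f @^-1` A) (N i) (y i))%:R -
      (visits f A (N i) (y i))%:R| <= 1 :> R.
    have := congr1 (fun k => k%:R : R) (visits_preimage f A (N i) (y i)).
    rewrite !natrD ler_norml.
    by do 2 case: (_ \in _) => /=; move=> h; apply/andP; split; lra.
  near=> i; rewrite sub0r normrN /u -mulrBl normrM.
  rewrite [X in _ * X]gtr0_norm ?invr_gt0// ler_pdivrMr// (le_trans (le1 i))//.
  rewrite -ler_pdivrMl// mulr1 (@le_trans _ _ i%:R)//.
    by near: i; exact: nbhs_infty_ger.
  by rewrite ler_nat ltnW.
- move=> A c h; apply: limr_le => //; apply: nearW => i.
  by rewrite ler_pdivrMr.
Unshelve. all: by end_near. Qed.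

End limit_frequency.

Lemma open_metric_ball {R : realType} {X : metricType R} (x : X) (r : R) :
  open (ball x r).
Proof.
rewrite openE => y; rewrite /interior ballEmdist /= => xyr.
apply/nbhs_ballP; exists (r - mdist x y); first by rewrite /= subr_gt0.
move=> z; rewrite ballEmdist /= ltrBrDl; apply: le_lt_trans.
exact: metric_triangle.
Qed.

(** These sets serve to shrink the members of an open cover to closed sets. *)
Lemma closed_ball_sub {R : realType} {X : metricType R} (U : set X) (r : R) :
  closed [set x | ball x r `<=` U].
Proof.
rewrite -[X in closed X]setCK; apply: open_closedC.
rewrite (_ : ~` _ = \bigcup_(y in ~` U) ball y r); last first.
  apply/seteqP; split => [x /= /existsNP[y /not_implyP[xy Uy]]|x [y Uy yx] xU].
    by exists y => //; exact: ball_sym.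
  by apply/Uy/xU/ball_sym.
by apply: bigcup_open => y _; exact: open_metric_ball.
Qed.

(* Ultrafilter limits of empirical measures are finitely additive on all
   subsets. Replacing such a [nu] by the supremum of its values on closed
   subsets makes it countably subadditive on open sets, by compactness, and
   the induced outer measure makes open sets Caratheodory measurable. *)
Section regularization.
Context {R : realType} {X : pmetricType R} (nu : set X -> R).
Hypothesis compactX : compact [set: X].
Hypothesis nu_ge0 : forall A, 0 <= nu A.
Hypothesis nuU : forall A B, A `&` B = set0 -> nu (A `|` B) = nu A + nu B.

Let nu0 : nu set0 = 0.
Proof. by have := nuU (setI0 set0); rewrite setU0 => h; lra. Qed.

Let le_nu A B : A `<=` B -> nu A <= nu B.
Proof.
move=> AB; rewrite -(setDUK AB) nuU ?lerDl//.
by rewrite setDE setICA setICr setI0.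
Qed.

Let nuU_le A B : nu (A `|` B) <= nu A + nu B.
Proof.
rewrite (_ : A `|` B = A `|` (B `\` A)); last first.
  by rewrite setUDr setDv setD0.
rewrite nuU; last by rewrite setDE setICA setICr setI0.
by rewrite lerD2l le_nu// => x [].
Qed.

Let nu_bigU (F : nat -> set X) n :
  nu (\big[setU/set0]_(i < n) F i) <= \sum_(i < n) nu (F i).
Proof.
elim: n => [|n IH]; first by rewrite !big_ord0 nu0.
by rewrite !big_ord_recr (le_trans (nuU_le _ _))// lerD2r.
Qed.

Local Open Scope ereal_scope.

Definition inner_content (U : set X) : \bar R :=
  ereal_sup [set (nu K)%:E | K in [set K | closed K /\ K `<=` U]].

Definition outer_content (A : set X) : \bar R :=
  ereal_inf [set inner_content U | U in [set U | open U /\ A `<=` U]].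

Lemma inner_content_ub K U : closed K -> K `<=` U ->
  (nu K)%:E <= inner_content U.
Proof. by move=> cK KU; apply: ereal_sup_ubound; exists K. Qed.

Lemma inner_content_le U : inner_content U <= (nu U)%:E.
Proof. by apply: ge_ereal_sup => _ [K [_ KU] <-]; rewrite lee_fin le_nu. Qed.

Lemma inner_content_ge0 U : 0 <= inner_content U.
Proof.
have : (nu set0)%:E <= inner_content U by apply: inner_content_ub => //; exact: closed0.
by rewrite nu0.
Qed.

Lemma inner_content_fin_num U : inner_content U \is a fin_num.
Proof.
rewrite ge0_fin_numE ?inner_content_ge0//.
by rewrite (le_lt_trans (inner_content_le U)) ?ltry.
Qed.

Lemma le_inner_content U V : U `<=` V -> inner_content U <= inner_content V.
Proof.
move=> UV; apply: ge_ereal_sup => _ [K [cK KU] <-].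
by apply: inner_content_ub => //; exact: subset_trans UV.
Qed.

(** A Lebesgue number argument: a single [n] serves a whole compact [K], each point of which has its
    ball of radius [1 / (n + 1)] inside one of the first [n] sets. The closed pieces [C i] then
    cover [K], and finite subadditivity of [nu] applies. *)
Lemma inner_content_bigcup (U : nat -> set X) : (forall i, open (U i)) ->
  inner_content (\bigcup_i U i) <= \sum_(i <oo) inner_content (U i).
Proof.
move=> oU; apply: ge_ereal_sup => _ [K [cK KU] <-].
have kK : compact K by exact: subclosed_compact cK compactX _.
pose P n x := exists2 i, (i < n)%N & ball x n.+1%:R^-1 `<=` U i.
have [n _ /(_ n (leqnn n)) KP] : \forall n \near \oo, K `<=` P n.
  apply: (proj1 (compact_near_coveringP K) kK nat \oo P _) => x /KU[i _ Uix].
  have /nbhs_ballP[r /= r0 xrU] : nbhs x (U i) by exact: open_nbhs_nbhs.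
  have : \forall n \near \oo, (i < n)%N /\ (n.+1%:R^-1 <= r / 2)%R.
    near=> n; split; first by near: n; exact: nbhs_infty_gt.
    by apply: ltW; near: n; exact: near_infty_natSinv_lt (PosNum (divr_gt0 r0 _)).
  have xr2 : nbhs x (ball x (r / 2)) by apply: nbhsx_ballx; rewrite divr_gt0.
  move=> inr; exists (ball x (r / 2), [set n | (i < n)%N /\ n.+1%:R^-1 <= r / 2]%R) => //.
  move=> [y n] /= [xy [lt_in nr]]; exists i => // z yz; apply: xrU.
  rewrite (splitr r); apply: ball_triangle xy _; exact: le_ball yz.
pose C i := K `&` [set x | ball x n.+1%:R^-1 `<=` U i].
apply: (@le_trans _ _ (\sum_(i < n) inner_content (U i))); last first.
  rewrite -(big_mkord xpredT (fun i => inner_content (U i))).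
  by apply: nneseries_lim_ge => i _ _; exact: inner_content_ge0.
apply: (@le_trans _ _ (\sum_(i < n) (nu (C i))%:E)).
  rewrite sumEFin lee_fin (le_trans _ (nu_bigU _ _))// le_nu// => x Kx.
  by have [i lt_in xi] := KP x Kx; rewrite -bigcup_mkord; exists i.
apply: lee_sum => i _; apply: inner_content_ub.
  by apply: closedI => //; exact: closed_ball_sub.
by move=> x [_]; apply; exact: ballxx.
Unshelve. all: by end_near. Qed.

Lemma outer_content_open U : open U -> outer_content U = inner_content U.
Proof.
move=> oU; apply/eqP; rewrite eq_le; apply/andP; split.
  by apply: ereal_inf_lbound; exists U => //; split.
by apply: le_ereal_inf_tmp => _ [V [_ UV] <-]; exact: le_inner_content.
Qed.

Lemma outer_content_ge0 A : 0 <= outer_content A.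
Proof.
by apply: le_ereal_inf_tmp => _ [V _ <-]; exact: inner_content_ge0.
Qed.

Lemma outer_content0 : outer_content set0 = 0.
Proof.
rewrite (outer_content_open open0); apply/eqP.
by rewrite eq_le inner_content_ge0 (le_trans (inner_content_le _))// nu0.
Qed.

Lemma le_outer_content A B : A `<=` B -> outer_content A <= outer_content B.
Proof.
move=> AB; apply: ereal_inf_le_tmp => _ [V [oV BV] <-]; exists V => //.
by split=> //; exact: subset_trans BV.
Qed.

Lemma outer_content_approx A (e : R) : (0 < e)%R ->
  exists V, [/\ open V, A `<=` V & inner_content V <= outer_content A + e%:E].
Proof.
move=> e0; have fA : outer_content A \is a fin_num.
  rewrite ge0_fin_numE ?outer_content_ge0//.
  rewrite (le_lt_trans (le_outer_content (@subsetT _ A)))//.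
  rewrite (outer_content_open openT).
  by have := inner_content_fin_num setT; rewrite ge0_fin_numE ?inner_content_ge0.
have [_ [V [oV AV] <-] /ltW VA] := lb_ereal_inf_adherent e0 fA.
by exists V.
Qed.

Lemma outer_content_sigma_subadditive : sigma_subadditive outer_content.
Proof.
move=> A; apply/lee_addgt0Pr => e e0.
apply: le_trans (epsilon_trick xpredT _ (ltW e0)); last first.
  by move=> n; exact: outer_content_ge0.
have /choice[V hV] (n : nat) : exists V, [/\ open V, A n `<=` V &
    inner_content V <= outer_content (A n) + (e / (2 ^ n.+1)%:R)%:E].
  by apply: outer_content_approx; rewrite divr_gt0// ltr0n expn_gt0.
apply: (@le_trans _ _ (inner_content (\bigcup_n V n))).
  apply: ereal_inf_lbound; exists (\bigcup_n V n) => //; split.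
    by apply: bigcup_open => n _; case: (hV n).
  by apply: subset_bigcup => n _; case: (hV n).
apply: le_trans (inner_content_bigcup _) _ => [n|]; first by case: (hV n).
apply: lee_nneseries => n _ //; first by move=> _; exact: inner_content_ge0.
by case: (hV n).
Qed.

HB.instance Definition _ := isOuterMeasure.Build R X outer_content
  outer_content0 outer_content_ge0 le_outer_content
  outer_content_sigma_subadditive.

(** Inside a nearly optimal open [V] around [A], take nearly optimal closed sets: [K] in the
    intersection of [V] and [U], then [L] in [V] minus [K]. They are disjoint, so [nu] adds up on
    them, and [V] minus [K] contains the part of [V] outside [U]. *)
Lemma open_caratheodory U : open U -> outer_content.-caratheodory U.
Proof.
move=> oU; apply: le_caratheodory_measurable => A.
apply/lee_addgt0Pr => e e0.
have e2 : (0 < e / 2)%R by rewrite divr_gt0.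
have [V [oV AV VA]] := outer_content_approx A e2.
apply: (@le_trans _ _ (inner_content V + (e / 2)%:E)); last first.
  by rewrite [in leRHS](splitr e) EFinD addeA leeD2r.
have oVU : open (V `&` U) by exact: openI.
apply: (@le_trans _ _ (inner_content (V `&` U) + outer_content (V `&` ~` U))).
  apply: leeD.
    by rewrite -(outer_content_open oVU) le_outer_content//; exact: setSI.
  by rewrite le_outer_content//; exact: setSI.
have e4 : (0 < e / 2 / 2)%R by rewrite divr_gt0.
have := ub_ereal_sup_adherent e4 (inner_content_fin_num (V `&` U)).
move=> [_ [K [cK KVU] <-]]; rewrite -/(inner_content _) => hK.
have oVK : open (V `&` ~` K) by apply: openI => //; exact: closed_openC.
have := ub_ereal_sup_adherent e4 (inner_content_fin_num (V `&` ~` K)).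
move=> [_ [L [cL LVK] <-]]; rewrite -/(inner_content _) => hL.
have hVK : outer_content (V `&` ~` U) <= inner_content (V `&` ~` K).
  rewrite -(outer_content_open oVK) le_outer_content// => x [Vx Ux].
  by split=> // /KVU[].
have KL : (nu K + nu L)%:E <= inner_content V.
  rewrite -nuU; last first.
    by apply/seteqP; split => // x [Kx /LVK[_]].
  by apply: inner_content_ub; [exact: closedU|move=> x [/KVU[]|/LVK[]]].
move: hK hL hVK KL.
move: (inner_content_fin_num (V `&` U)) (inner_content_fin_num (V `&` ~` K))
  (inner_content_fin_num V).
move=> /fineK <- /fineK <- /fineK <-.
rewrite -!EFinB !lte_fin !lee_fin => hK hL hVK KL.
rewrite (le_trans (leeD2l _ hVK))// -!EFinD lee_fin.
by lra.
Qed.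

Local Notation borel := (g_sigma_algebraType (@open X)).

Lemma borel_caratheodory (A : set borel) : measurable A ->
  outer_content.-caratheodory A.
Proof.
apply: smallest_sub => [|U oU]; last exact: open_caratheodory.
split; first exact: caratheodory_measurable_set0.
- by move=> B cB; rewrite setTD; exact: caratheodory_measurable_setC.
- by move=> F cF; exact: caratheodory_measurable_bigcup.
Qed.

(** Retyped over [borel], so that the measure structure is attached to the Borel sigma-algebra. *)
Let borel_content : set borel -> \bar R := outer_content.

Let borel_content0 : borel_content set0 = 0.
Proof. exact: outer_content0. Qed.

Let borel_content_ge0 A : 0 <= borel_content A.
Proof. exact: outer_content_ge0. Qed.

Let borel_content_sigma_additive : semi_sigma_additive borel_content.
Proof.
move=> A mA tA mUA.
apply: (@caratheodory_measure_sigma_additive R X outer_content A) => //.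
- by move=> i; exact: borel_caratheodory.
- exact: borel_caratheodory.
Qed.

HB.instance Definition _ := isMeasure.Build _ _ _ borel_content
  borel_content0 borel_content_ge0 borel_content_sigma_additive.

Hypothesis nuT : (nu setT = 1)%R.

Let borel_contentT : borel_content setT = 1.
Proof.
rewrite /borel_content (outer_content_open openT); apply/eqP.
rewrite eq_le (le_trans (inner_content_le _)) ?nuT//=.
by rewrite -nuT inner_content_ub//; exact: closedT.
Qed.

HB.instance Definition _ := Measure_isProbability.Build _ _ _
  borel_content borel_contentT.

Lemma exists_regularization : exists mu : probability borel R,
  forall U, open U ->
    mu U = ereal_sup [set (nu K)%:E | K in [set K | closed K /\ K `<=` U]].
Proof. by exists borel_content => U oU; exact: outer_content_open. Qed.

End regularization.

(** * Comparison of Borel probabilities on open and closed sets *)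

Section borel_probability.
Context {R : realType} {X : pmetricType R}.
Local Notation borel := (g_sigma_algebraType (@open X)).
Implicit Types (mu nu : probability borel R) (F : set X) (f : X -> X).

Lemma open_measurable_borel (U : set X) :
  open U -> measurable (U : set borel).
Proof. exact: sub_sigma_algebra. Qed.

Lemma closed_measurable_borel F : closed F -> measurable (F : set borel).
Proof.
move=> cF; rewrite -[F]setCK; apply: measurableC.
by apply: open_measurable_borel; exact: closed_openC.
Qed.

Lemma borel_probability_ext (mu nu : {measure set borel -> \bar R}) :
  (mu setT < +oo)%E ->
  (forall U : set X, open U -> mu U = nu U) ->
  forall A : set borel, measurable A -> mu A = nu A.
Proof.
move=> muT munu A mA.
apply: (@measure_unique _ R borel (@open X) (fun=> setT) _ _ _ _ mu nu) => //.
- by move=> U V oU oV; exact: openI.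
- by move=> _; exact: openT.
- by rewrite bigcup_const//; exists 0%N.
Qed.

(** Continuity from above along the radii [1 / (n + 1)]: closedness makes [F] the intersection of
    its neighborhoods. *)
Lemma closed_nbhd_probability mu F (e : R) : closed F -> 0 < e ->
  exists2 r : R, 0 < r & (mu (\bigcup_(x in F) ball x r) < mu F + e%:E)%E.
Proof.
move=> cF e0; pose U (n : nat) : set borel := \bigcup_(x in F) ball x n.+1%:R^-1.
have oU n : measurable (U n).
  apply: open_measurable_borel.
  by apply: bigcup_open => x _; exact: open_metric_ball.
have UF : \bigcap_n U n = F.
  apply/seteqP; split => [x Ux|x Fx n _]; last by exists x => //; exact: ballxx.
  apply: cF => B /nbhs_ballP[r /= r0 xrB].
  have [n _ /(_ n (leqnn n)) nr] := near_infty_natSinv_lt (PosNum r0).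
  have [y Fy yx] := Ux n I; exists y; split => //; apply: xrB.
  by apply: le_ball (ball_sym yx); exact: ltW nr.
have Ucvg : (mu \o U) @ \oo --> mu F.
  rewrite -UF; apply: nonincreasing_cvg_mu => //.
  - by rewrite -ge0_fin_numE// fin_num_measure.
  - exact: bigcap_measurable.
  - move=> m n mn; apply/subsetPset => x [y Fy yx]; exists y => //.
    by apply: le_ball yx; rewrite lef_pV2 ?posrE// ler_nat ltnS.
have fF : mu F \is a fin_num.
  by rewrite fin_num_measure//; exact: closed_measurable_borel.
apply: contrapT => noR; have : (mu F + e%:E <= mu F)%E.
  rewrite -[leRHS](cvg_lim _ Ucvg)//; apply: lime_ge; first exact: cvgP Ucvg.
  apply: nearW => n /=; rewrite leNgt; apply/negP => h.
  by apply: noR; exists n.+1%:R^-1.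
by move/fineK: fF => <-; rewrite -EFinD lee_fin; lra.
Qed.

Lemma continuous_borel_measurable f : continuous f ->
  measurable_fun [set: borel] (f : borel -> borel).
Proof.
move=> /continuousP cf.
apply: (@measurability _ _ borel borel setT f (@open X)) => // _ [U oU <-].
by rewrite setTI; apply: open_measurable_borel; exact: cf.
Qed.

(** The inequality passes to closed sets, whose [nu]-measure is approximated by that of open
    neighborhoods; taking complements reverses it. *)
Lemma le_open_probability_eq mu nu :
  (forall U : set X, open U -> (mu U <= nu U)%E) ->
  forall A : set borel, measurable A -> mu A = nu A.
Proof.
move=> le_mu; apply: borel_probability_ext => [|U oU].
  by apply: (@le_lt_trans _ _ 1%E); rewrite ?ltry// -(probability_setT mu).
apply/eqP; rewrite eq_le le_mu//=.
have cF : closed (~` U) by exact: open_closedC.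
have mF := closed_measurable_borel cF; have mU := open_measurable_borel oU.
suff : (mu (~` U) <= nu (~` U))%E.
  rewrite !probability_setC//.
  have /fineK <- : mu U \is a fin_num by exact: fin_num_measure.
  have /fineK <- : nu U \is a fin_num by exact: fin_num_measure.
  by rewrite -!EFinB !lee_fin; lra.
apply/lee_addgt0Pr => e e0.
have [r r0 /ltW nur] := closed_nbhd_probability nu cF e0.
have oV : open (\bigcup_(x in ~` U) ball x r).
  by apply: bigcup_open => x _; exact: open_metric_ball.
apply: le_trans nur; apply: le_trans (le_mu _ oV); apply: le_measure.
- by rewrite inE.
- by rewrite inE; exact: open_measurable_borel.
- by move=> x Ux; exists x => //; exact: ballxx.
Qed.

(** The comparison of [mu] with its push-forward, again a probability, upgrades the inequality to an
    equality. *)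
Lemma invariant_measure_le_open f mu : continuous f ->
  (forall U : set X, open U -> (mu U <= mu (f @^-1` U))%E) ->
  invariant_measure f mu.
Proof.
move=> cf le_mu A mA.
pose mfb := isMeasurableFun.Build _ _ _ _ _ (continuous_borel_measurable cf).
pose f' : {mfun borel >-> borel} := HB.pack (f : borel -> borel) mfb.
exact/esym/(@le_open_probability_eq mu (distribution mu f') le_mu).
Qed.

End borel_probability.

(** The base points [y i] may vary, so that segments with prescribed frequencies leave a trace in
    the limit. Frequency bounds pass to open sets because [mu U] is a supremum over closed subsets;
    invariance holds because preimages of closed sets are closed. *)
Lemma krylov_bogolyubov {R : realType} {X : pmetricType R} (f : X -> X)
    (y : nat -> X) (N : nat -> nat) :
  compact [set: X] -> continuous f -> (forall i, (i < N i)%N) ->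
  exists2 mu : probability (g_sigma_algebraType (@open X)) R,
    invariant_measure f mu &
    forall (U : set X) (c : R), open U ->
      (forall i, (visits f U (N i) (y i))%:R <= c * (N i)%:R) ->
      (mu U <= c%:E)%E.
Proof.
move=> cX cf /(@limit_frequency R X f y)[nu [nu0 nuT nuU nuf nule]].
have [mu muE] := exists_regularization cX nu0 nuU nuT.
exists mu => [|U c oU hU]; last first.
  rewrite muE//; apply: ge_ereal_sup => _ [K [cK KU] <-]; rewrite lee_fin.
  apply: nule => i; apply: le_trans (hU i); rewrite ler_nat.
  apply: leq_sum => j _; case: (boolP (_ \in K)) => // /set_mem jK.
  by rewrite mem_set//; exact: KU.
apply: invariant_measure_le_open => // U oU.
have /continuousP cf' := cf; rewrite !muE//; last exact: cf'.
apply: ge_ereal_sup => _ [K [cK KU] <-]; apply: ereal_sup_ubound.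
exists (f @^-1` K); last by rewrite nuf.
by split; [apply: closed_comp => // x _; exact: cf|move=> x; exact: KU].
Qed.

(** * Zero entropy implies unique ergodicity *)

Lemma visits_indic {R : realType} T (f : T -> T) (A : set T) n x :
  (visits f A n x)%:R = \sum_(j < n) \1_(iter j f @^-1` A) x :> R.
Proof. by rewrite /visits natr_sum; apply: eq_bigr => j _; rewrite indicE. Qed.

Section visits_integral.
Context {R : realType} {X : pmetricType R} (f : X -> X).
Local Notation borel := (g_sigma_algebraType (@open X)).
Hypothesis continuous_f : continuous f.
Variable mu : probability borel R.
Hypothesis invariant_mu : invariant_measure f mu.

Let iter_preimage (A : set borel) j : measurable A ->
  measurable (iter j f @^-1` A : set borel) /\ mu (iter j f @^-1` A) = mu A.
Proof.
move=> mA; elim: j => [|j [mj muj]]; first by split.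
have -> : iter j.+1 f @^-1` A = f @^-1` (iter j f @^-1` A).
  by apply/funext => x; exact: (congr1 A (iterSr j f x)).
rewrite invariant_mu//; split=> //.
rewrite -[X in measurable X]setTI.
exact: (continuous_borel_measurable continuous_f).
Qed.

Lemma integral_visits (A : set borel) n : measurable A ->
  (\int[mu]_x ((visits f A n x)%:R%:E) = n%:R%:E * mu A)%E.
Proof.
move=> mA.
rewrite (eq_integral (fun x : borel =>
    \sum_(j < n) (\1_(iter j f @^-1` A : set borel) x)%:E))%E; last first.
  by move=> x _; rewrite sumEFin visits_indic.
rewrite ge0_integral_sum//; last first.
  move=> j; apply/measurable_EFinP; apply: measurable_indic.
  exact: (iter_preimage j mA).1.
rewrite (eq_bigr (fun=> mu A)).
  by rewrite big_const_ord iter_addr_0 mule_natl.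
move=> j _; rewrite integral_indic//; last exact: (iter_preimage j mA).1.
by rewrite setIT; exact: (iter_preimage j mA).2.
Qed.

Let measurable_visits (A : set borel) n : measurable A ->
  measurable_fun [set: borel] (fun x : borel => ((visits f A n x)%:R : R)%:E).
Proof.
move=> mA; apply/measurable_EFinP.
rewrite (_ : (fun _ => _) =
    fun x : borel => \sum_(j < n) (\1_(iter j f @^-1` A : set borel) x : R)).
  by apply: measurable_sum => j; apply: measurable_indic; exact: (iter_preimage j mA).1.
by apply/funext => x; rewrite visits_indic.
Qed.

Let integral_const (c : R) : (\int[mu]_x cst c%:E x = c%:E)%E.
Proof.
rewrite integral_cst// -[RHS]mule1; congr (_ * _)%E; exact: probability_setT.
Qed.

(** By invariance the visit count has mean [n * mu A], so it cannot stay below [n * a]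
    everywhere. *)
Lemma exists_visits_ge (A : set borel) (a : R) n : measurable A -> (0 < n)%N ->
  (a%:E < mu A)%E -> exists x, n%:R * a <= (visits f A n x)%:R.
Proof.
move=> mA n0 aA; apply: contrapT => /forallNP nx.
have : (\int[mu]_x ((visits f A n x)%:R%:E) <= \int[mu]_x (cst (n%:R * a)%:E x))%E.
  apply: ge0_le_integral => //.
  - exact: measurable_visits.
  - by move=> x _; rewrite lee_fin ltW// ltNge; apply/negP/nx.
rewrite integral_visits// integral_const EFinM.
by rewrite lee_pmul2l ?lte_fin ?ltr0n// leNgt aA.
Qed.

Lemma exists_visits_le (A : set borel) (b : R) n : measurable A -> (0 < n)%N ->
  (mu A < b%:E)%E -> exists x, (visits f A n x)%:R <= n%:R * b.
Proof.
move=> mA n0 Ab; apply: contrapT => /forallNP nx.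
have b0 : 0 <= b by rewrite -lee_fin (le_trans _ (ltW Ab)).
have : (\int[mu]_x (cst (n%:R * b)%:E x) <= \int[mu]_x ((visits f A n x)%:R%:E))%E.
  apply: ge0_le_integral => //.
  - by move=> x _; rewrite lee_fin mulr_ge0.
  - exact: measurable_visits.
  - by move=> x _; rewrite lee_fin ltW// ltNge; apply/negP/nx.
rewrite integral_visits// integral_const EFinM.
by rewrite lee_pmul2l ?lte_fin ?ltr0n// leNgt Ab.
Qed.

End visits_integral.

(** * Counts in shifted windows and drifts *)

Section window_sums.
Implicit Types (P : nat -> bool) (n s d : nat).

Lemma window_sum_succ P n s :
  (P s + \sum_(j < n) P (s.+1 + j) = \sum_(j < n) P (s + j) + P (s + n))%N.
Proof.
transitivity (\sum_(j < n.+1) P (s + j))%N; last by rewrite big_ord_recr.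
rewrite big_ord_recl addn0; congr (_ + _)%N; apply: eq_bigr => j _.
by rewrite addSnnS.
Qed.

(** Shifting a window by one step drops one time and adds another, hence changes the count by at
    most one. *)
Lemma leq_window_sum P n s s' d : (s <= s' + d)%N -> (s' <= s + d)%N ->
  (\sum_(j < n) P (s + j) <= \sum_(j < n) P (s' + j) + d)%N.
Proof.
elim: d s => [|d IH] s ss' s's.
  by rewrite addn0; have -> : s = s' by lia.
have [lt|gt|->] := ltngtP s s'; last exact: leq_addr.
- have := IH s.+1 ltac:(lia) ltac:(lia).
  by have := window_sum_succ P n s; case: (P s); case: (P (s + n)%N) => /=; lia.
- case: s ss' s's gt => // s ss' s's gt.
  have := IH s ltac:(lia) ltac:(lia).
  by have := window_sum_succ P n s; case: (P s); case: (P (s + n)%N) => /=; lia.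
Qed.

End window_sums.

Lemma card_pred_ord n (P : 'I_n -> bool) :
  #|[pred j | P j]| = (\sum_(j < n) P j)%N.
Proof.
rewrite -sum1_card big_mkcond; apply: eq_bigr => j _.
by rewrite inE; case: (P j).
Qed.

(* The drifts are compared through their quotients by [Q], which grow by at
   most one over two consecutive steps. *)
Lemma drift_close (Q L : nat) (e e' : nat -> nat) : (0 < Q)%N ->
  (forall i, 2 * e i <= Q)%N -> (forall i, 2 * e' i <= Q)%N ->
  let D k := (\sum_(i < k) e i)%N in let D' k := (\sum_(i < k) e' i)%N in
  (forall l, (l < L)%N -> (D (2 * l.+1) %/ Q == D (2 * l) %/ Q)%N =
                          (D' (2 * l.+1) %/ Q == D' (2 * l) %/ Q)%N) ->
  forall k, (k < 2 * L)%N -> (D k <= D' k + 2 * Q)%N.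
Proof.
move=> Q0 eQ e'Q D D' DD' k kL.
(* Two steps add at most [Q], so the quotient by [Q] either stays or grows by one; the bit tells
   which. *)
have step (g : nat -> nat) : (forall i, 2 * g i <= Q)%N -> forall l,
    let G k := (\sum_(i < k) g i)%N in
    [/\ (G (2 * l) <= G (2 * l).+1)%N, (G (2 * l).+1 <= G (2 * l) + Q)%N &
     (G (2 * l.+1) %/ Q)%N = (G (2 * l) %/ Q + (G (2 * l.+1) %/ Q != G (2 * l) %/ Q))%N].
  move=> gQ l G; have G1 : G (2 * l).+1 = (G (2 * l) + g (2 * l))%N.
    by rewrite /G big_ord_recr.
  have G2 : G (2 * l.+1)%N = (G (2 * l) + g (2 * l) + g (2 * l).+1)%N.
    by rewrite mulnS /G 2!big_ord_recr.
  have := gQ (2 * l)%N; have := gQ (2 * l).+1 => h1 h2; split; [lia|lia|].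
  have lo : (G (2 * l) %/ Q <= G (2 * l.+1) %/ Q)%N by apply: leq_div2r; lia.
  have hi : (G (2 * l.+1) %/ Q <= (G (2 * l) %/ Q).+1)%N.
    have : (G (2 * l.+1) <= G (2 * l) + Q)%N by lia.
    by move/(leq_div2r Q); rewrite divnDr ?dvdnn// divnn Q0 addn1.
  by case: eqP => /=; lia.
have q l : (l <= L)%N -> (D (2 * l) %/ Q)%N = (D' (2 * l) %/ Q)%N.
  elim: l => [|l IH] lL; first by rewrite /D /D' muln0 !big_ord0.
  have [_ _ ->] := step _ eQ l; have [_ _ ->] := step _ e'Q l.
  by rewrite -/(D _) -/(D' _) DD'// IH// ltnW.
(* Equal quotients at the last even time up to [k] leave a difference below [Q]; a remaining odd
   step adds at most [Q]. *)
have := odd_double_half k; rewrite -mul2n => kE.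
have := q k./2 ltac:(lia).
have [a1 a2 _] := step _ eQ k./2; have [b1 b2 _] := step _ e'Q k./2.
rewrite -/(D _) -/(D _) in a1 a2; rewrite -/(D' _) -/(D' _) in b1 b2.
have := divn_eq (D (2 * k./2)%N) Q; have := divn_eq (D' (2 * k./2)%N) Q.
have := ltn_pmod (D (2 * k./2)%N) Q0; have := ltn_pmod (D' (2 * k./2)%N) Q0.
move=> m1 m2 d1 d2 qq; rewrite qq in d2.
by rewrite -kE; case: (odd k) kE => /=; rewrite ?add0n ?add1n => kE; lia.
Qed.

Lemma exists_large_fiber (S T : finType) (p : S -> T) (m : nat) :
  (m * #|T| <= #|S|)%N -> (0 < #|T|)%N ->
  exists t, (m <= #|[pred s | p s == t]|)%N.
Proof.
move=> mT T0; apply: contrapT => /forallNP lt_m.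
have : (#|S| <= \sum_(t : T) #|[pred s | p s == t]|)%N.
  rewrite -sum1_card (partition_big p xpredT)//=; apply: leq_sum => t _.
  by rewrite -sum1_card.
have : (\sum_(t : T) #|[pred s | p s == t]| < \sum_(t : T) m)%N.
  have [t0 _] : exists t0 : T, t0 \in T by apply/card_gt0P.
  rewrite (bigD1 t0)//= [ltnRHS](bigD1 t0)//= -addSn leq_add//.
    by rewrite ltnNge; apply/negP/lt_m.
  by apply: leq_sum => t _; apply: ltnW; rewrite ltnNge; apply/negP/lt_m.
rewrite sum_nat_const mulnC => ltT leT.
by have := leq_ltn_trans leT ltT; rewrite ltnNge mT.
Qed.

Lemma leq_sum_except n (P Q B : nat -> bool) :
  (forall j, (j < n)%N -> P j -> ~~ B j -> Q j) ->
  (\sum_(j < n) P j <= \sum_(j < n) Q j + \sum_(j < n) B j)%N.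
Proof.
move=> PQB; rewrite -big_split; apply: leq_sum => j _ /=.
have := PQB j (ltn_ord j); case: (P j) => //= /(_ isT).
by case: (B j) => /=; [rewrite addn1|move=> ->].
Qed.

(** * Separated sets and lower bounds for the entropy *)

Section separated.
Context {R : realType} {X : metricType R} (f : X -> X).
Implicit Types (e : R) (n : nat).
Local Open Scope ereal_scope.

Lemma max_separated_ge0 n e : 0 <= max_separated f n e.
Proof. by apply: ereal_sup_ubound; exists fset0 => //; rewrite cardfs0. Qed.

(** Separation at a nonnegative scale makes [z] injective on [A], so no cardinality is lost in the
    image. *)
Lemma le_max_separated n e (T : finType) (A : {pred T}) (z : T -> X) :
  (0 <= e)%R ->
  (forall s t, s \in A -> t \in A -> s != t ->
    exists2 i, (i < n)%N & (e < mdist (iter i f (z s)) (iter i f (z t)))%R) ->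
  (#|A|%:R)%:E <= max_separated f n e.
Proof.
move=> e0 sepA; apply: ereal_sup_ubound.
exists [fset z s | s in enum A]%fset => /=.
  move=> _ _ /imfsetP[s /= sA ->] /imfsetP[t /= tA ->] zst.
  rewrite mem_enum in sA; rewrite mem_enum in tA; apply: sepA => //.
  by apply: contra_neq zst => ->.
rewrite card_in_imfset/= ?undup_id ?enum_uniq// -?cardE//.
move=> s t; rewrite !mem_enum => sA tA zst; have [//|st] := eqVneq s t.
have [i _] := sepA s t sA tA st.
by rewrite zst mdistxx ltNge e0.
Qed.

(** Every tail of the sequence contains a multiple of [N], which bounds the limit superior from
    below. *)
Lemma le_entropy_at_scale (N : nat) e : (0 < N)%N ->
  (forall L, (0 < L)%N -> ((2 ^ L)%N%:R)%:E <= max_separated f (N * L) e) ->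
  (ln 2 / N%:R)%:E <= entropy_at_scale f e.
Proof.
move=> N0 hL; rewrite /entropy_at_scale limn_esup_lim.
apply: lime_ge; first exact: is_cvg_esups.
apply: nearW => m; set u := fun n : nat => _.
apply: (@le_trans _ _ (u (N * m.+1)%N)); last first.
  apply: ereal_sup_ubound; exists (N * m.+1)%N => //=.
  by rewrite (leq_trans (leqnSn m))// leq_pmull.
have hlne : lne ((2 ^ m.+1)%N%:R)%:E <= lne (max_separated f (N * m.+1) e).
  by rewrite lee_lne ?hL// in_itv/= leey andbT ?lee_fin ?max_separated_ge0.
apply: (@le_trans _ _ (((N * m.+1)%N%:R^-1)%:E * lne ((2 ^ m.+1)%N%:R)%:E)).
  rewrite lne_EFin ?ltr0n ?expn_gt0// natrX lnXn// -EFinM lee_fin natrM.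
  rewrite -[(ln 2 *+ _)%R]mulr_natr invfM.
  rewrite [leRHS](_ : _ = (ln 2 / N%:R * (m.+1%:R / m.+1%:R))%R); last by ring.
  by rewrite divff ?mulr1// pnatr_eq0.
by apply: lee_wpmul2l => //; rewrite lee_fin invr_ge0.
Qed.

End separated.

Lemma traced_visits {R : realType} {X : metricType R} (f : X -> X)
    (x : nat -> X) (t : nat -> nat) (n k : nat) (delta e : R) (z : X) :
  traced f x (fun=> n) t delta e z ->
  (\sum_(j < n) (e < mdist (iter (trace_start (fun=> n) t k + j)%N f z)
                           (iter j f (x k)))%R)%N%:R <= delta * n%:R.
Proof. by move=> /(_ k); rewrite card_pred_ord. Qed.

(** Each gap delays all later segments by [t i - 1]; the sum is the drift from the ideal starting
    time [k * n]. *)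
Lemma trace_start_drift n (t : nat -> nat) k : (forall i, 0 < t i)%N ->
  trace_start (fun=> n) t k = (k * n + \sum_(i < k) (t i).-1)%N.
Proof.
move=> t0; rewrite /trace_start.
have -> : (k * n = \sum_(i < k) n)%N by rewrite sum_nat_const card_ord.
rewrite -big_split.
by apply: eq_bigr => i _ /=; rewrite -addnBA// subn1.
Qed.

(** * Coding of binary words by traced orbits *)

Section coding.
Context {R : realType} {X : metricType R} (f : X -> X) (F : set X).
Variables (r a b : R) (px py : nat -> X).
Hypothesis app_f : approximate_product_property f.
Hypotheses (r0 : 0 < r) (ba : b < a).
Hypothesis visits_px : forall n, (0 < n)%N -> n%:R * a <= (visits f F n (px n))%:R.
Hypothesis visits_py : forall n, (0 < n)%N ->
  (visits f (\bigcup_(u in F) ball u r) n (py n))%:R <= n%:R * b.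

Let r3 : r / 4 + r / 4 + r / 4 < r.
Proof. by move: r0 => h; lra. Qed.

(* If the two orbits stayed [r / 4]-close, then [py n] would visit the
   neighborhood of [F] almost as often as [px n] visits [F]. *)
Lemma codes_separated (n N Q s s' : nat) (z z' : X) (delta : R) : (0 < n)%N ->
  2 * delta * n%:R + (2 * Q)%N%:R < (a - b) * n%:R ->
  (s <= s' + 2 * Q)%N -> (s' <= s + 2 * Q)%N -> (s' + n <= N)%N ->
  (\sum_(j < n) (r / 4 < mdist (iter (s + j)%N f z) (iter j f (px n)))%R)%N%:R
    <= delta * n%:R ->
  (\sum_(j < n) (r / 4 < mdist (iter (s' + j)%N f z') (iter j f (py n)))%R)%N%:R
    <= delta * n%:R ->
  exists2 i, (i < N)%N & r / 4 < mdist (iter i f z) (iter i f z').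
Proof.
move=> n0 gap ss' s's s'N tz tz'; apply: contrapT => nsep.
have close i : (i < N)%N -> mdist (iter i f z) (iter i f z') <= r / 4.
  by move=> iN; rewrite leNgt; apply/negP => h; apply: nsep; exists i.
(* Visits are passed on from [px n] in [F] to [z] in [F1], then to the window at [s'] at a cost of
   [2 * Q], then to [z'] in [F2], and finally to [py n] within [3 * r / 4] of [F]. *)
pose F1 := [set w | exists2 u, F u & mdist u w <= r / 4].
pose F2 := [set w | exists2 u, F u & mdist u w <= r / 4 + r / 4].
have h1 : (visits f F n (px n) <= \sum_(j < n) (iter (s + j)%N f z \in F1) +
    \sum_(j < n) (r / 4 < mdist (iter (s + j)%N f z) (iter j f (px n)))%R)%N.
  apply: (@leq_sum_except n (fun j => iter j f (px n) \in F)
    (fun j => iter (s + j)%N f z \in F1)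
    (fun j => r / 4 < mdist (iter (s + j)%N f z) (iter j f (px n)))).
  move=> j _ /set_mem Fj; rewrite -leNgt => dj; apply/mem_set.
  by exists (iter j f (px n)) => //; rewrite metric_sym.
have h2 : (\sum_(j < n) (iter (s + j)%N f z \in F1) <=
    \sum_(j < n) (iter (s' + j)%N f z \in F1) + 2 * Q)%N.
  exact: (@leq_window_sum (fun i => iter i f z \in F1)).
have h3 : (\sum_(j < n) (iter (s' + j)%N f z \in F1) <=
    \sum_(j < n) (iter (s' + j)%N f z' \in F2))%N.
  apply: leq_sum => j _; case: (boolP (_ \in F1)) => // /set_mem[u Fu uz].
  rewrite mem_set//; exists u => //; apply: le_trans (metric_triangle _ _ _) _.
  apply: lerD uz _; apply: close; apply: leq_trans s'N; rewrite ltn_add2l.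
  exact: ltn_ord.
have h4 : (\sum_(j < n) (iter (s' + j)%N f z' \in F2) <=
    visits f (\bigcup_(u in F) ball u r) n (py n) +
    \sum_(j < n) (r / 4 < mdist (iter (s' + j)%N f z') (iter j f (py n)))%R)%N.
  apply: (@leq_sum_except n (fun j => iter (s' + j)%N f z' \in F2)
    (fun j => iter j f (py n) \in \bigcup_(u in F) ball u r)
    (fun j => r / 4 < mdist (iter (s' + j)%N f z') (iter j f (py n)))).
  move=> j _ /set_mem[u Fu uz]; rewrite -leNgt => dj; apply/mem_set.
  exists u => //; rewrite ballEmdist /=.
  apply: le_lt_trans (metric_triangle _ (iter (s' + j)%N f z') _) _.
  by apply: le_lt_trans r3; exact: lerD.
have : (visits f F n (px n) <= visits f (\bigcup_(u in F) ball u r) n (py n) +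
  \sum_(j < n) (r / 4 < mdist (iter (s + j)%N f z) (iter j f (px n)))%R +
  \sum_(j < n) (r / 4 < mdist (iter (s' + j)%N f z') (iter j f (py n)))%R + 2 * Q)%N by lia.
rewrite -(ler_nat R) 3!natrD => h.
have := visits_px n0; have := visits_py n0; lra.
Qed.

Lemma coding_entropy : exists e c : R,
  [/\ 0 < e, 0 < c & (c%:E <= entropy_at_scale f e)%E].
Proof.
have g0 : 0 < a - b by rewrite subr_gt0.
(* [R0] makes [Q = n %/ R0] smaller than [n * (a - b) / 8], so that with a mismatch proportion of
   [(a - b) / 8] all losses total less than [(a - b) * n]. The gap bound [1 / (4 * R0)] keeps the
   drift added by each segment below [Q / 2]. *)
pose R0 := (Num.truncn (8 / (a - b))).+1.
have R0g : 8 < R0%:R * (a - b) by rewrite -ltr_pdivrMr// truncnS_gt.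
have d1 : 0 < (4 * R0)%N%:R^-1 :> R by rewrite invr_gt0 ltr0n.
have d2 : 0 < (a - b) / 8 by rewrite divr_gt0.
have r4 : 0 < r / 4 by rewrite divr_gt0.
have [M M0 traceM] := app_f d1 d2 r4.
pose n := maxn R0 (Num.truncn M).+1.
have Mn : M < n%:R.
  by rewrite (lt_le_trans (truncnS_gt M))// ler_nat leq_maxr.
have nR0 : (R0 <= n)%N by exact: leq_maxl.
have n0 : (0 < n)%N by exact: leq_trans nR0.
pose Q := (n %/ R0)%N.
have Q0 : (0 < Q)%N by rewrite divn_gt0.
have QR0 : (Q * R0 <= n)%N by exact: leq_trunc_div.
have gap : 2 * ((a - b) / 8) * n%:R + (2 * Q)%N%:R < (a - b) * n%:R.
  have Qn : Q%:R * R0%:R <= n%:R :> R by rewrite -natrM ler_nat.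
  have n0' : 0 < n%:R :> R by rewrite ltr0n.
  have Q0' : 0 < Q%:R :> R by rewrite ltr0n.
  have : Q%:R * 8 < n%:R * (a - b).
    apply: (@lt_le_trans _ _ (Q%:R * (R0%:R * (a - b)))); first by rewrite ltr_pM2l.
    by rewrite mulrA ler_pM2r.
  by rewrite natrM; nra.
(* The [2 * L] segments take [2 * L * n] steps and the drift at most as many, so [2 ^ L] orbits are
   separated within [4 * n * L] steps. *)
exists (r / 4), (ln 2 / (4 * n)%N%:R); split => //.
  by rewrite divr_gt0 ?ltr0n ?muln_gt0// ln_gt0 ?ltr1n.
apply: le_entropy_at_scale => [|L L0]; first by rewrite muln_gt0.
(* Tracing needs an infinite sequence: past the word, it is filled up with [px n]. *)
pose code (w : {ffun 'I_(2 * L) -> bool}) (k : nat) : X :=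
  if insub k is Some i then if w i then px n else py n else px n.
have codeE w (k : 'I_(2 * L)) : code w k = if w k then px n else py n.
  by rewrite /code valK.
have /choice[tz htz] (w : {ffun 'I_(2 * L) -> bool}) : exists tz : (nat -> nat) * X,
    (forall k, (0 < tz.1 k)%N /\ (2 * (tz.1 k).-1 <= Q)%N) /\
    traced f (code w) (fun=> n) tz.1 ((a - b) / 8) (r / 4) tz.2.
  have [t [ht [z hz]]] := traceM n Mn (code w); exists (t, z); split => // k.
  have [t0 t1] := ht k; split => //=; rewrite leq_divRL//.
  have : (t k).-1%:R * (4 * R0)%N%:R <= n%:R :> R.
    rewrite -ler_pdivlMr ?ltr0n// mulrC.
    have : (t k)%:R = 1 + (t k).-1%:R :> R by rewrite -(natrD _ 1) add1n prednK.
    by lra.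
  rewrite -natrM ler_nat; apply: leq_trans.
  by rewrite [(2 * _)%N]mulnC -mulnA leq_mul2l leq_mul2r !orbT.
pose D w k := (\sum_(i < k) ((tz w).1 i).-1)%N.
have DQ w i : (2 * ((tz w).1 i).-1 <= Q)%N by case: ((htz w).1 i).
(* There are only [2 ^ L] patterns for [2 ^ (2 * L)] words, so some fiber contains at least [2 ^ L]
   words. *)
pose pat (w : {ffun 'I_(2 * L) -> bool}) : {ffun 'I_L -> bool} :=
  [ffun l : 'I_L => D w (2 * l.+1)%N %/ Q == D w (2 * l)%N %/ Q]%N.
have [p hp] : exists p, (2 ^ L <= #|[pred w | pat w == p]|)%N.
  apply: exists_large_fiber; rewrite !card_ffun card_bool !card_ord.
    by rewrite -expnD addnn mul2n.
  by rewrite expn_gt0.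
apply: (@le_trans _ _ (#|[pred w | pat w == p]|%:R)%:E).
  by rewrite lee_fin ler_nat.
have patD w w' k : pat w = pat w' -> (k < 2 * L)%N -> (D w k <= D w' k + 2 * Q)%N.
  move=> ww'; apply: (@drift_close Q L (fun i => ((tz w).1 i).-1)
    (fun i => ((tz w').1 i).-1)) => // l lL.
  by have := congr1 (fun g : {ffun 'I_L -> bool} => g (Ordinal lL)) ww'; rewrite !ffunE.
(* At a letter where the words differ, one orbit follows [px n] and the other [py n], in windows
   whose starts differ by at most [2 * Q]. *)
have sep w w' (k : 'I_(2 * L)) : pat w = pat w' -> w k -> ~~ w' k ->
    exists2 i, (i < 4 * n * L)%N &
      r / 4 < mdist (iter i f (tz w).2) (iter i f (tz w').2).
  move=> ww' wk w'k.
  have tw0 i : (0 < (tz w).1 i)%N by case: ((htz w).1 i).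
  have tw'0 i : (0 < (tz w').1 i)%N by case: ((htz w').1 i).
  have := traced_visits k (htz w).2; have := traced_visits k (htz w').2.
  rewrite !codeE wk (negbTE w'k) !trace_start_drift// -/(D w k) -/(D w' k).
  move=> hw' hw; apply: (codes_separated n0 gap) hw hw'.
  - by rewrite -addnA leq_add2l patD.
  - by rewrite -addnA leq_add2l patD.
  - have Dk : (D w' k <= k * n)%N.
      have -> : (k * n = \sum_(i < k) n)%N by rewrite sum_nat_const card_ord.
      apply: leq_sum => i _; apply: leq_trans (leq_div n R0).
      by apply: leq_trans (DQ w' i); exact: leq_pmull.
    have kn : (k.+1 * n <= 2 * L * n)%N by rewrite leq_mul2r ltn_ord orbT.
    have -> : (4 * n * L = 2 * L * n + 2 * L * n)%N by clear; ring.
    rewrite -addnA; apply: leq_add; first by apply: leq_trans kn; exact: leq_mul.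
    by apply: leq_trans kn; rewrite [leqLHS]addnC [leqRHS]mulSn leq_add2l.
apply: le_max_separated; first exact: ltW.
move=> w w'; rewrite !inE => /eqP pw /eqP pw' ww'.
have [k wk] : exists k, w k != w' k.
  apply: contrapT => /forallNP same; move/eqP: ww'; apply; apply/ffunP => k.
  by apply/eqP; apply: contrapT => /negP; exact: same.
have pww' : pat w = pat w' by rewrite pw pw'.
case: (boolP (w k)) wk => wk /=; case: (boolP (w' k)) => w'k // _.
  exact: sep pww' wk w'k.
have [i iN hi] := sep _ _ _ (esym pww') w'k wk.
by exists i => //; rewrite metric_sym.
Qed.

End coding.

Lemma entropy0_unique {R : realType} {X : pmetricType R} (f : X -> X)
    (mu nu : probability (g_sigma_algebraType (@open X)) R) :
  continuous f -> approximate_product_property f ->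
  topological_entropy f = 0%E -> invariant_measure f mu ->
  invariant_measure f nu ->
  forall A : set (g_sigma_algebraType (@open X)), measurable A -> mu A = nu A.
Proof.
move=> cf app_f h0 imu inu.
suff le_closed mu' nu' : invariant_measure f mu' -> invariant_measure f nu' ->
    forall F : set X, closed F -> (mu' F <= nu' F :> \bar R)%E.
  apply: le_open_probability_eq => U oU.
  have cF : closed (~` U) by exact: open_closedC.
  have mU := open_measurable_borel oU.
  have := le_closed nu mu inu imu _ cF; rewrite !probability_setC//.
  have /fineK <- : mu U \is a fin_num by exact: fin_num_measure.
  have /fineK <- : nu U \is a fin_num by exact: fin_num_measure.
  by rewrite -!EFinB !lee_fin; lra.
move=> imu' inu' F cF; rewrite leNgt; apply/negP => lt_nu_mu.
have mF := closed_measurable_borel cF.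
have fmu : mu' F \is a fin_num by exact: fin_num_measure.
have fnu : nu' F \is a fin_num by exact: fin_num_measure.
pose m := fine (mu' F); pose m' := fine (nu' F).
have mm' : m' < m by rewrite -lte_fin !fineK.
have [r r0 hr] : exists2 r : R, 0 < r &
    (nu' (\bigcup_(x in F) ball x r) < nu' F + ((m - m') / 2)%:E)%E.
  by apply: closed_nbhd_probability => //; rewrite divr_gt0// subr_gt0.
have mFr : measurable (\bigcup_(x in F) ball x r : set (g_sigma_algebraType (@open X))).
  apply: open_measurable_borel; apply: bigcup_open => x _.
  exact: open_metric_ball.
(* The two thresholds lie below [mu' F] and above the [nu']-measure of the neighborhood, and still
   differ by [(m - m') / 6]. *)
have /choice[px hpx] (n : nat) : exists x, (0 < n)%N ->
    n%:R * (m - (m - m') / 3) <= (visits f F n x)%:R :> R.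
  case: n => [|n]; first by exists point.
  have [|x hx] := exists_visits_ge cf imu' mF (ltn0Sn n) (a := m - (m - m') / 3).
    by rewrite -[ltRHS]fineK// lte_fin -/m; lra.
  by exists x.
have /choice[py hpy] (n : nat) : exists x, (0 < n)%N ->
    (visits f (\bigcup_(x in F) ball x r) n x)%:R <= n%:R * (m' + (m - m') / 2) :> R.
  case: n => [|n]; first by exists point.
  have [|x hx] := exists_visits_le cf inu' mFr (ltn0Sn n) (b := m' + (m - m') / 2).
    by rewrite EFinD fineK.
  by exists x.
have [|e [c [e0 c0 hc]]] := coding_entropy app_f r0 _ hpx hpy; first by lra.
suff : (c%:E <= topological_entropy f)%E by rewrite h0 lee_fin leNgt c0.
apply: lime_ge; first exact: is_cvg_entropy_at_scale.
near=> e'; apply: le_trans hc _; apply: entropy_at_scale_nonincreasing.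
by near: e'; exact: nbhs_right_le.
Unshelve. all: by end_near. Qed.

(** * Unique ergodicity implies zero entropy *)

Lemma sum_ord_filter n (P : nat -> bool) :
  (\sum_(j < n) P j)%N = size [seq j <- iota 0 n | P j].
Proof.
elim: n => [|n IH]; first by rewrite big_ord0.
have -> : iota 0 n.+1 = iota 0 n ++ [:: n] by rewrite -addn1 iotaD.
rewrite big_ord_recr /= IH filter_cat size_cat /=.
by case: (P n).
Qed.

Lemma leq_sum_inj n N (P Q : nat -> bool) (h : nat -> nat) :
  (forall j, (j < n)%N -> P j -> (h j < N)%N /\ Q (h j)) ->
  (forall i j, (i < n)%N -> (j < n)%N -> P i -> P j -> h i = h j -> i = j) ->
  (\sum_(j < n) P j <= \sum_(i < N) Q i)%N.
Proof.
move=> hPQ hinj; rewrite !sum_ord_filter -(size_map h); apply: uniq_leq_size.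
  rewrite map_inj_in_uniq ?filter_uniq ?iota_uniq// => i j.
  by rewrite !mem_filter !mem_iota !add0n => /andP[? ?] /andP[? ?]; exact: hinj.
move=> x /mapP[j + ->]; rewrite mem_filter mem_iota add0n => /andP[Pj /= jn].
by have [hN Qh] := hPQ j jn Pj; rewrite mem_filter mem_iota add0n Qh.
Qed.

Lemma sum_ord_blocks n L (F : nat -> nat) :
  (\sum_(i < L * n) F i = \sum_(l < L) \sum_(j < n) F (l * n + j))%N.
Proof.
elim: L => [|L IH]; first by rewrite mul0n !big_ord0.
by rewrite mulSnr big_split_ord big_ord_recr /= IH.
Qed.

Lemma increasing_interval (s : nat -> nat) i : s 0 = 0%N ->
  (forall k, s k < s k.+1)%N -> exists2 k, (s k <= i)%N & (i < s k.+1)%N.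
Proof.
move=> s0 incr; have si k : (k <= s k)%N.
  by elim: k => // k IH; apply: leq_ltn_trans IH (incr k).
have ex : exists k, (i < s k)%N by exists i.+1; exact: si.
have := ex_minnP ex => -[[|k] ik mink]; first by rewrite s0 in ik.
by exists k => //; rewrite leqNgt; apply/negP => /mink; rewrite ltnn.
Qed.

(** * Windows of an orbit that traces one segment repeatedly *)

Section templates.
Context {R : realType} {X : metricType R} (f : X -> X).

(* A window of length [n] of an orbit tracing [x0] again and again consists of
   the end of the segment begun [v] steps earlier and of the beginning of the
   next segment, which starts [u] steps later. *)
Definition template (x0 : X) (v u j : nat) : X :=
  if (j < u)%N then iter (v + j) f x0 else iter (j - u) f x0.

(** The window meets at most two consecutive segments, each contributing a proportion [delta2] of
    mismatches, and the gap between them, contributing [delta1]. *)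
Lemma window_template (n : nat) (t : nat -> nat) (delta1 delta2 e : R)
    (x0 z : X) (i : nat) :
  (0 < n)%N -> delta1 <= 1 ->
  (forall k, (0 < t k)%N /\ (t k)%:R <= 1 + delta1 * n%:R) ->
  traced f (fun=> x0) (fun=> n) t delta2 e z ->
  exists v : 'I_(2 * n), exists u : 'I_n.+1,
    (\sum_(j < n) (e < mdist (iter (i + j)%N f z) (template x0 v u j))%R)%N%:R
      <= (2 * delta2 + delta1) * n%:R.
Proof.
move=> n0 d1 ht tr; pose s := trace_start (fun=> n) t.
have t0 k : (0 < t k)%N by case: (ht k).
have sS k : s k.+1 = (s k + n + (t k).-1)%N.
  by rewrite /s /trace_start big_ord_recr /= -addnBA// subn1 addnA.
have td k : (t k).-1%:R <= delta1 * n%:R.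
  have [_] := ht k; have : (t k)%:R = 1 + (t k).-1%:R :> R.
    by rewrite -(natrD _ 1) add1n prednK.
  by lra.
have tn k : ((t k).-1 <= n)%N.
  by rewrite -(ler_nat R) (le_trans (td k))// ler_piMl.
have [||k ski isk] := @increasing_interval s i.
- by rewrite /s /trace_start big_ord0.
- by move=> k; rewrite sS -addnA -[ltnLHS]addn0 ltn_add2l ltn_addr.
(* The window may begin inside a gap, of length at most [n], hence the bound [2 * n]. The cap of [u]
   at [n] covers windows that end before the next segment starts. *)
have bv : (i - s k < 2 * n)%N.
  rewrite ltn_subLR// (leq_trans isk)// sS -addnA leq_add2l mul2n -addnn.
  by rewrite leq_add2l.
have bu : (minn n (s k.+1 - i) < n.+1)%N by rewrite ltnS geq_minl.
exists (Ordinal bv), (Ordinal bu) => /=.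
set v := (i - s k)%N; set u := minn n _.
pose B k m := e < mdist (iter (s k + m)%N f z) (iter m f x0).
have hB k' : (\sum_(m < n) B k' m)%N%:R <= delta2 * n%:R by exact: traced_visits.
(* In turn: mismatches in the current segment, times in the gap, and mismatches in the next
   segment. *)
pose P1 j := [&& (j < u)%N, (v + j < n)%N & B k (v + j)%N].
pose P2 j := [&& (j < u)%N & (n <= v + j)%N].
pose P3 j := (u <= j)%N && B k.+1 (j - u)%N.
have ivs : (i = s k + v)%N by rewrite /v subnKC.
have le3 : (\sum_(j < n) (e < mdist (iter (i + j)%N f z) (template x0 v u j))%R <=
    \sum_(j < n) P1 j + \sum_(j < n) P2 j + \sum_(j < n) P3 j)%N.
  rewrite -!big_split; apply: leq_sum => -[j jn] _ /=.
  rewrite /P1 /P2 /P3 /template; case: (ltnP j u) => ju /=; last first.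
    rewrite /B; have -> // : (s k.+1 + (j - u) = i + j)%N.
    by rewrite /u in ju *; lia.
  rewrite /B addnA -ivs.
  by case: ltnP => /= vj; rewrite ?addn0//; case: (_ < _)%R.
have le1 : (\sum_(j < n) P1 j <= \sum_(m < n) B k m)%N.
  apply: (@leq_sum_inj _ _ _ _ (addn v)) => [j jn /and3P[]//|a b _ _ _ _].
  exact: addnI.
have le2 : (\sum_(j < n) P2 j <= (t k).-1)%N.
  rewrite -[leqRHS]card_ord -sum1_card.
  apply: (@leq_sum_inj _ (t k).-1 _ (fun=> true) (fun j => v + j - n)%N).
    move=> j jn /andP[ju nvj]; split=> //; rewrite ltn_subLR//.
    have := sS k; rewrite /u in ju; rewrite /v; lia.
  by move=> a b _ _ /andP[_ na] /andP[_ nb]; lia.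
have le4 : (\sum_(j < n) P3 j <= \sum_(m < n) B k.+1 m)%N.
  apply: (@leq_sum_inj _ _ _ _ (subn^~ u)) => [j jn /andP[uj ->]|a b _ _].
    by split=> //; rewrite (leq_ltn_trans (leq_subr _ _)).
  by move=> /andP[ua _] /andP[ub _]; lia.
have : (\sum_(j < n) (e < mdist (iter (i + j)%N f z) (template x0 v u j))%R <=
    \sum_(m < n) B k m + (t k).-1 + \sum_(m < n) B k.+1 m)%N.
  by apply: leq_trans le3 _; apply: leq_add le4; exact: leq_add.
rewrite -(ler_nat R) 2!natrD => h; have := hB k; have := hB k.+1; have := td k.
by lra.
Qed.

End templates.

(** * Counting sparse functions *)

Section sparse_functions.
Context {R : realType} (C : finType) (N : nat).

(** A Chernoff bound: with weight [expR (- s)] for each defined value, every counted function weighs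
    at least [expR (- s * K)], while the total weight is [(1 + #|C| * expR (- s)) ^ N]. *)
Lemma card_sparse (s K : R) : 0 <= s ->
  #|[pred g : {ffun 'I_N -> option C} |
      (\sum_i isSome (g i))%N%:R <= K]|%:R <=
  expR (s * K + N%:R * (#|C|%:R * expR (- s))).
Proof.
move=> s0; pose w (o : option C) : R := if o is Some _ then expR (- s) else 1.
have w0 o : 0 <= w o by case: o => [c|] //=; exact: expR_ge0.
have wE (g : {ffun 'I_N -> option C}) :
    \prod_i w (g i) = expR (- s * (\sum_i isSome (g i))%N%:R).
  rewrite natr_sum mulr_sumr expR_sum; apply: eq_bigr => i _.
  by case: (g i) => [c|] /=; rewrite ?mulr1// mulr0 expR0.
have sumw : \sum_(o : option C) w o = 1 + #|C|%:R * expR (- s).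
  rewrite (bigD1 None)//=; congr (_ + _).
  rewrite (eq_bigr (fun=> expR (- s))) => [|[]//].
  by rewrite sumr_const cardC1 card_option mulr_natl.
have total : \sum_(g : {ffun 'I_N -> option C}) \prod_i w (g i) =
    (1 + #|C|%:R * expR (- s)) ^+ N.
  by rewrite -(bigA_distr_bigA (fun _ : 'I_N => w)) /= prodr_const card_ord sumw.
set A := [pred g | _]; rewrite expRD -ler_pdivrMl ?expR_gt0// -expRN.
apply: (@le_trans _ _ (\sum_(g in A) \prod_i w (g i))).
  rewrite mulr_natr -sumr_const; apply: ler_sum => g; rewrite inE => gK.
  by rewrite wE ler_expR mulNr lerN2 ler_wpM2l.
apply: (@le_trans _ _ (\sum_(g : {ffun 'I_N -> option C}) \prod_i w (g i))).
  by rewrite big_mkcond; apply: ler_sum => g _; case: ifP => // _; exact: prodr_ge0.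
rewrite total expRM_natl lerXn2r ?nnegrE ?expR_ge0//.
exact: expR_ge1Dx.
Qed.

End sparse_functions.

(** * Semicontinuity of counts and rarity of exceptional windows *)

Lemma finite_cells {R : realType} {X : pmetricType R} (e : R) :
  compact [set: X] -> 0 < e ->
  exists (C : finType) (cell : X -> C),
    forall x y, cell x = cell y -> mdist x y <= e.
Proof.
move=> + e0; rewrite compact_cover => /(_ X setT (fun x => ball x (e / 2))).
move=> [x _|x _|D _ Dcov]; first exact: open_metric_ball.
  by exists x => //; apply: ballxx; rewrite divr_gt0.
have /choice[cell hcell] x : exists c : D, ball (val c) (e / 2) x.
  by have [c cD cx] := Dcov x I; exists [` cD]%fset.
exists D, cell => x y cxy; apply: ltW.
have xc := hcell x; have yc := hcell y; rewrite -cxy in yc.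
suff : ball x e y by rewrite ballEmdist.
by rewrite (splitr e); apply: ball_triangle yc; exact: ball_sym.
Qed.

Lemma open_mdist_gt {R : realType} {X : metricType R} (c : X) (e : R) :
  open [set w | e < mdist w c].
Proof.
rewrite openE => w /= ew; apply/nbhs_ballP.
exists (mdist w c - e); first by rewrite /= subr_gt0.
move=> w'; rewrite ballEmdist /= => ww'.
by have := metric_triangle w w' c; lra.
Qed.

Lemma closed_mdist_ge {R : realType} {X : metricType R} (c : X) (e : R) :
  closed [set w | e <= mdist w c].
Proof.
rewrite -[X in closed X]setCK; apply: open_closedC.
rewrite (_ : ~` _ = ball c e); first exact: open_metric_ball.
apply/seteqP; split => w; rewrite ballEmdist /= metric_sym.
  by move/negP; rewrite -ltNge.
by move=> cw; apply/negP; rewrite -ltNge.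
Qed.

(** Near [w], the finitely many memberships in open sets persist, so the count cannot drop. *)
Lemma open_count_gt {R : realType} {X : topologicalType} n (O : 'I_n -> set X)
    (c : R) : (forall j, open (O j)) ->
  open [set w | c < (\sum_j (w \in O j))%N%:R].
Proof.
move=> oO; rewrite openE => w /= cw.
have : \forall w' \near w, forall j, O j w -> O j w'.
  apply: filter_forall => j; have [Ow|nOw] := pselect (O j w).
    have : nbhs w (O j) by exact: open_nbhs_nbhs.
    by apply: filterS => w' ? _.
  by apply: nearW => w' /nOw.
apply: filterS => w' ww' /=; apply: lt_le_trans cw _; rewrite ler_nat.
apply: leq_sum => j _; case: (boolP (w \in O j)) => // /set_mem Ow.
by rewrite mem_set//; exact: ww'.
Qed.

(** Dually, no new membership in a closed set appears near [w], so the count cannot grow. *)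
Lemma open_count_le {R : realType} {X : topologicalType} n (C : 'I_n -> set X)
    (c : R) : (forall j, closed (C j)) ->
  open [set w | (\sum_j (w \in C j))%N%:R <= c].
Proof.
move=> cC; rewrite openE => w /= wc.
have : \forall w' \near w, forall j, C j w' -> C j w.
  apply: filter_forall => j; have [Cw|nCw] := pselect (C j w).
    by apply: nearW => w' _.
  have : nbhs w (~` C j) by apply: open_nbhs_nbhs; split=> //; exact: closed_openC.
  by apply: filterS => w' nCw' /nCw'.
apply: filterS => w' ww' /=; apply: le_trans wc; rewrite ler_nat.
apply: leq_sum => j _; case: (boolP (w' \in C j)) => // /set_mem Cw'.
by rewrite mem_set//; exact: ww'.
Qed.

(** Otherwise, ever longer segments visiting [F] with frequency above [gamma] have a limit giving
    [F] mass at least [gamma], whereas the limit along the orbit of [z] vanishes on [V]. Only open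
    sets inherit upper bounds in the limit, hence [F] is closed and [V] open. *)
Lemma uniquely_ergodic_visits {R : realType} {X : pmetricType R} (f : X -> X)
    (F V : set X) (z : X) (gamma : R) :
  compact [set: X] -> continuous f -> uniquely_ergodic f ->
  closed F -> open V -> F `<=` V -> (forall i, ~ V (iter i f z)) -> 0 < gamma ->
  exists N0, forall N y, (N0 <= N)%N -> (visits f F N y)%:R <= gamma * N%:R.
Proof.
move=> cX cf [mu _ mu_unique] cF oV FV zV g0; apply: contrapT => /forallNP noN0.
have /choice[Ny hNy] (i : nat) : exists Ny : nat * X,
    (i < Ny.1)%N /\ gamma * Ny.1%:R < (visits f F Ny.1 Ny.2)%:R.
  have /existsNP[N /existsNP[y /not_implyP[iN /negP]]] := noN0 i.+1.
  by rewrite -ltNge => h; exists (N, y).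
have [nu1 inu1 hnu1] := krylov_bogolyubov (R := R) (snd \o Ny) cX cf (fun i => (hNy i).1).
have [nu2 inu2 hnu2] := krylov_bogolyubov (R := R) (fun=> z) cX cf ltnSn.
have mF := closed_measurable_borel cF; have mV := open_measurable_borel oV.
have nuE : nu1 F = nu2 F :> \bar R by rewrite (mu_unique _ inu1)// (mu_unique _ inu2).
have V0 : (nu2 V <= 0)%E.
  apply: hnu2 => // i; rewrite mul0r /visits big1// => j _.
  by case: (boolP (_ \in V)) => // /set_mem /zV.
have F0 : (nu2 F <= 0)%E by apply: le_trans V0; apply: le_measure; rewrite ?inE.
have oF : open (~` F) by exact: closed_openC.
have := hnu1 (~` F) (1 - gamma) oF.
rewrite probability_setC// nuE; have -> : nu2 F = 0%E by apply/eqP; rewrite eq_le F0/=.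
rewrite sube0 lee_fin => h; suff : 1 <= 1 - gamma by lra.
apply: h => i /=; have [_] := hNy i; set N := (Ny i).1; set y := (Ny i).2.
have := visitsU f N y (setICr F); rewrite setUv visitsT => /(congr1 (fun k => k%:R : R)).
by rewrite natrD; lra.
Qed.

(** An average over the [n] residue classes: some class carries at most an [n]-th of the marked
    times. *)
Lemma exists_phase (b : nat -> bool) n L v : (0 < n)%N ->
  (\sum_(i < L * n) b i <= v)%N ->
  exists r : 'I_n, (n * \sum_(l < L) b (l * n + r) <= v)%N.
Proof.
rewrite (sum_ord_blocks n L (fun i => nat_of_bool (b i))) exchange_big /=.
move=> n0 bv.
apply: contrapT => /forallNP nr.
have : (\sum_(r < n) v.+1 <= \sum_(r < n) n * \sum_(l < L) b (l * n + r))%N.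
  by apply: leq_sum => r _; rewrite ltnNge; apply/negP/nr.
rewrite sum_nat_const card_ord -big_distrr /= leq_pmul2l// => /leq_trans/(_ bv).
by rewrite ltnn.
Qed.

(** * Codes of orbits and the size of separated sets *)

Section separated_count.
Context {R : realType} {X : metricType R} (f : X -> X).
Variables (T C : finType) (t0 : T) (tau : T -> nat -> X) (cell : X -> C).
Variables (n N : nat) (e delta gamma : R).
Hypotheses (n0 : (0 < n)%N) (delta0 : 0 <= delta) (delta1 : delta <= 1).

(** The non-strict inequality makes the set [F] below closed when [f] is continuous. *)
Definition mismatches (p : T) (w : X) : nat :=
  (\sum_(j < n) (2 * e <= mdist (iter j f w) (tau p j))%R)%N.

Let F : set X := [set w | forall p, delta * n%:R < (mismatches p w)%:R].

Hypothesis cell_close : forall x y, cell x = cell y -> mdist x y <= 4 * e.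
Hypothesis visitsF : forall y, (visits f F N y)%:R <= gamma * N%:R.

Let L := (N %/ n).+1.
(** Blocks beginning in [F] account for [gamma * N] exceptions, the other blocks for
    [delta * (N + n)], at most [delta * N + n], and the times before the phase for [n]. *)
Let K := (gamma + delta) * N%:R + 2 * n%:R.

Let NL : (N <= L * n)%N.
Proof. by rewrite ltnW// /L -ltn_divLR. Qed.

Let LN : (L * n <= N + n)%N.
Proof. by rewrite /L mulSnr leq_add2r leq_trunc_div. Qed.

Let err (r : nat) (p : nat -> T) (y : X) (i : nat) : bool :=
  (i < r)%N ||
  (2 * e <= mdist (iter i f y) (tau (p ((i - r) %/ n)%N) ((i - r) %% n)%N)).

(** The phase is chosen so that few blocks begin in [F]; each of these costs up to [n] exceptions,
    and any other block has a template with at most [delta * n] mismatches. *)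
Lemma exists_orbit_code y : exists (r : 'I_n) (p : nat -> T),
  (\sum_(i < N) err r p y i)%N%:R <= K.
Proof.
(* The cut at [N] is needed because the [L] blocks may extend beyond time [N]. *)
pose b i := (i < N)%N && (iter i f y \in F).
have bN : (\sum_(i < L * n) b i <= visits f F N y)%N.
  by apply: (@leq_sum_inj _ _ b (fun j => iter j f y \in F) id) => // j _ /andP[].
have [r hr] := exists_phase n0 bN.
have /choice[pt hpt] (w : X) : exists p, ~ F w -> (mismatches p w)%:R <= delta * n%:R.
  have [Fw|/existsNP[p /negP]] := pselect (F w); first by exists t0.
  by rewrite -leNgt => h; exists p.
pose p l := pt (iter (l * n + r) f y); exists r, p.
pose err' i := (i < N)%N && err r p y i.
have le1 : (\sum_(i < N) err r p y i <= \sum_(i < r + L * n) err' i)%N.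
  apply: (@leq_sum_inj _ _ _ _ id) => // j jN ej; rewrite /err' jN ej; split=> //.
  by rewrite (leq_trans jN)// (leq_trans NL)// leq_addl.
have le2 : (\sum_(i < r + L * n) err' i <=
    n + \sum_(l < L) \sum_(j < n) err' (r + (l * n + j)))%N.
  rewrite big_split_ord /= -(sum_ord_blocks n L (fun i => nat_of_bool (err' (r + i)%N))).
  rewrite leq_add2r (leq_trans _ (ltnW (ltn_ord r)))//.
  by rewrite -[leqRHS]card_ord -sum1_card; apply: leq_sum => i _; case: (err' _).
have le3 (l : 'I_L) : (\sum_(j < n) err' (r + (l * n + j)))%N%:R <=
    delta * n%:R + (n * b (l * n + r))%N%:R :> R.
  case: (boolP (b _)) => bl.
    rewrite muln1 -[leLHS]add0r lerD ?mulr_ge0// ler_nat.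
    by rewrite -[leqRHS]card_ord -sum1_card; apply: leq_sum => j _; case: (err' _).
  rewrite muln0 addr0; move: bl; rewrite negb_and -leqNgt => /orP[Nl|/negP nF].
    rewrite big1 ?mulr_ge0// => j _; rewrite /err' ltnNge addnA [(r + _)%N]addnC.
    by rewrite (leq_trans Nl)// leq_addr.
  have {}nF : ~ F (iter (l * n + r) f y) by move=> Fl; apply: nF; apply/mem_set.
  apply: le_trans (hpt _ nF); rewrite ler_nat; apply: leq_sum => j _.
  rewrite /err'; case: (_ < N)%N => //=; rewrite /err ltnNge leq_addr /= addKn.
  rewrite divnMDl// divn_small// addn0 modnMDl modn_small// -/(p l) -iterD.
  by have -> : (r + (l * n + j) = j + (l * n + r))%N 
    by rewrite addnCA [RHS]addnCA [(r + _)%N]addnC.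
have le4 : (\sum_(l < L) \sum_(j < n) err' (r + (l * n + j)))%N%:R <=
    L%:R * (delta * n%:R) + (n * \sum_(l < L) b (l * n + r))%N%:R :> R.
  rewrite natr_sum (le_trans (ler_sum _ (fun l _ => le3 l)))// big_split /=.
  by rewrite sumr_const card_ord mulr_natl lerD2l big_distrr /= natr_sum.
have le5 : (\sum_(i < N) err r p y i)%N%:R <= n%:R +
    (\sum_(l < L) \sum_(j < n) err' (r + (l * n + j)))%N%:R :> R.
  by rewrite -natrD ler_nat (leq_trans le1).
have le6 : L%:R * (delta * n%:R) <= delta * (N%:R + n%:R) :> R.
  by rewrite mulrCA ler_wpM2l// -natrM -natrD ler_nat LN.
have le7 : (n * \sum_(l < L) b (l * n + r))%N%:R <= gamma * N%:R :> R.
  by apply: le_trans (visitsF y); rewrite ler_nat.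
have le8 : delta * n%:R <= n%:R by rewrite ler_piMl.
by rewrite /K; lra.
Qed.

(** The code consists of the phase, the [L] templates and the cells at exceptional times. It is
    injective on [E]: under equal codes, at each time both orbits lie in the same cell or both are
    within [2 * e] of the same template, hence they are never separated. *)
Lemma card_bowen_separated (E : {fset X}) (s : R) :
  bowen_separated f N (4 * e) E -> 0 <= s ->
  #|` E|%:R <= n%:R * #|T|%:R ^+ L *
    expR (s * K + N%:R * (#|C|%:R * expR (- s))).
Proof.
move=> sepE s0.
have /choice[rp hrp] (y : X) : exists rp : 'I_n * (nat -> T),
    (\sum_(i < N) err rp.1 rp.2 y i)%N%:R <= K.
  by have [r [p h]] := exists_orbit_code y; exists (r, p).
pose g y : {ffun 'I_N -> option C} :=
  [ffun i : 'I_N => if err (rp y).1 (rp y).2 y i then Some (cell (iter i f y)) else None].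
pose code y := ((rp y).1, [ffun l : 'I_L => (rp y).2 l], g y).
pose A := [pred g : {ffun 'I_N -> option C} | (\sum_i isSome (g i))%N%:R <= K].
have code_inj : {in E &, injective code}.
  move=> y y' yE y'E [rr /ffunP pp /ffunP gg]; apply: contrapT => /eqP yy'.
  have [k kN] := sepE y y' yE y'E yy'; rewrite ltNge => /negP; apply.
  have := gg (Ordinal kN); rewrite !ffunE /=.
  case: (boolP (err _ _ y k)) => [_|ey].
    by case: ifP => // _ [] /cell_close.
  case: (boolP (err _ _ y' k)) => // ey' _; move: ey ey'.
  have kL : ((k - (rp y).1) %/ n < L)%N.
    by rewrite ltnS leq_div2r// (leq_trans (leq_subr _ _))// ltnW.
  have := pp (Ordinal kL); rewrite !ffunE /= rr => ppk.
  rewrite /err ppk !negb_or -!ltNge => /andP[_ h1] /andP[_ h2].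
  rewrite metric_sym in h2; apply: le_trans (metric_triangle _ _ _) _.
  by apply: le_trans (ltW (ltrD h1 h2)) _; lra.
have sub : (#|` E| <= #|[predX [pred _ : 'I_n * {ffun 'I_L -> T} | true] & A]|)%N.
  rewrite [leqRHS]cardE -(size_map code); apply: uniq_leq_size.
    by rewrite map_inj_in_uniq// fset_uniq.
  move=> c /mapP[y yE ->]; rewrite mem_enum inE /=.
  apply: le_trans (hrp y); rewrite ler_nat; apply: leq_sum => i _.
  by rewrite /g ffunE; case: ifP.
rewrite cardX in sub.
apply: (@le_trans _ _ ((n * #|T| ^ L)%N * #|A|)%N%:R).
  rewrite ler_nat (leq_trans sub)// leq_mul2r; apply/orP; right.
  by rewrite (leq_trans (max_card _))// card_prod card_ord card_ffun card_ord.
rewrite !natrM natrX ler_wpM2l ?mulr_ge0 ?exprn_ge0//.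
exact: card_sparse.
Qed.

End separated_count.

(** The left side is the number of templates. The cube of [expR (a * n / 3)] is at least
    [a ^ 3 * n ^ 3 / 27], which exceeds [4 * n ^ 2] once [a ^ 3 * n] reaches 108. *)
Lemma quadratic_le_expR {R : realType} (a : R) : 0 < a ->
  exists n0, forall n, (n0 <= n)%N -> (2 * n * n.+1)%N%:R <= expR (a * n%:R).
Proof.
move=> a0; exists (Num.truncn (108 / a ^+ 3)).+1 => n n0n.
have n0 : 0 < n%:R :> R by rewrite ltr0n (leq_trans _ n0n).
have n1 : 1 <= n%:R :> R by rewrite ler1n -(ltr0n R).
have an : 108 <= a ^+ 3 * n%:R.
  rewrite mulrC -ler_pdivrMr ?exprn_gt0// (le_trans (ltW (truncnS_gt _)))//.
  by rewrite ler_nat.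
have an0 : 0 <= a * n%:R / 3 by rewrite divr_ge0// mulr_ge0 ?ltW.
have -> : a * n%:R = 3%:R * (a * n%:R / 3) by field.
rewrite expRM_natl; apply: (@le_trans _ _ ((a * n%:R / 3) ^+ 3)); last first.
  rewrite lerXn2r ?nnegrE ?expR_ge0//.
  by apply: le_trans (expR_ge1Dx _); rewrite lerDr.
rewrite 2!natrM -[n.+1]addn1 natrD.
have -> : (a * n%:R / 3) ^+ 3 = (a ^+ 3 * n%:R) / 27 * n%:R ^+ 2 by field.
apply: (@le_trans _ _ (4 * n%:R ^+ 2)); first by nra.
by apply: ler_wpM2r; [rewrite exprn_ge0// ltW|rewrite ler_pdivlMr//; lra].
Qed.

(** * Subexponential growth of separated sets *)

Section unique_ergodicity_entropy.
Context {R : realType} {X : pmetricType R} (f : X -> X).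
Hypothesis compactX : compact [set: X].
Hypothesis continuous_f : continuous f.

Lemma continuous_iter j : continuous (iter j f).
Proof.
elim: j => [|j IH] x; first exact: cvg_id.
by apply: continuous_comp; [exact: IH|exact: continuous_f].
Qed.

Lemma closed_mismatches (T : finType) (tau : T -> nat -> X) n (e c : R) :
  closed [set w | forall p, c < (mismatches f tau n e p w)%:R].
Proof.
rewrite -[X in closed X]setCK; apply: open_closedC.
rewrite (_ : ~` _ = \bigcup_(p in [set: T])
    [set w | (\sum_(j < n)
       (w \in iter j f @^-1` [set v | (2 * e <= mdist v (tau p j))%R]))%N%:R <= c]).
  apply: bigcup_open => p _; apply: open_count_le => j.
  apply: closed_comp => [x _|]; [exact: continuous_iter|exact: closed_mdist_ge].
have E p w : mismatches f tau n e p w = (\sum_(j < n)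
    (w \in iter j f @^-1` [set v | (2 * e <= mdist v (tau p j))%R]))%N.
  by apply: eq_bigr => j _; congr nat_of_bool; apply/idP/idP; rewrite inE.
apply/seteqP; split => w /=.
  by move=> /existsNP[p /negP]; rewrite -leNgt E => h; exists p.
by move=> [p _]; rewrite /= -E leNgt => /negP h wp; exact: h.
Qed.

Lemma uniquely_ergodic_card_le (e eta : R) :
  approximate_product_property f -> uniquely_ergodic f -> 0 < e -> 0 < eta ->
  exists N0, forall N, (N0 <= N)%N ->
    (max_separated f N e <= (expR (eta * N%:R))%:E)%E.
Proof.
move=> app_f ue e0 eta0.
have [C [cell hcell]] := finite_cells compactX e0.
(* Since [expR s] is at least [1 + s], this choice brings the cost of the cells down to [eta / 8]
   per step. *)
pose s : R := 8 * #|C|%:R / eta.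
have s0 : 0 <= s by rewrite divr_ge0 ?mulr_ge0// ltW.
have Cs : #|C|%:R * expR (- s) <= eta / 8.
  rewrite expRN ler_pdivrMr ?expR_gt0//.
  have h := expR_ge1Dx s; apply: (@le_trans _ _ (eta / 8 * (1 + s))).
    have -> : eta / 8 * (1 + s) = eta / 8 + #|C|%:R by rewrite /s; field; rewrite gt_eqF.
    by rewrite lerDr divr_ge0// ltW.
  by rewrite ler_wpM2l// divr_ge0// ltW.
(* Small enough for [s * d <= eta / 8]. Tracing with both proportions equal to [d / 3] yields
   templates with at most [d * n] mismatches. *)
pose d : R := Num.min 1 (eta / (8 * (s + 1))).
have s1 : 0 < s + 1 by rewrite ltr_wpDl.
have d0 : 0 < d by rewrite lt_min ltr01 divr_gt0// mulr_gt0.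
have d1 : d <= 1 by rewrite ge_min lexx.
have sd : s * d <= eta / 8.
  apply: (@le_trans _ _ ((s + 1) * d)); first by rewrite ler_wpM2r ?lerDl// ltW.
  have : d <= eta / (8 * (s + 1)) by rewrite ge_min lexx orbT.
  rewrite ler_pdivlMr ?mulr_gt0// => h; lra.
have d3 : 0 < d / 3 by rewrite divr_gt0.
have e8 : 0 < e / 8 by rewrite divr_gt0.
have [M M0 traceM] := app_f _ _ _ d3 d3 e8.
have [n1 hn1] := quadratic_le_expR (divr_gt0 eta0 (ltr0n R 8)).
pose n := maxn n1 (Num.truncn M).+1.
have Mn : M < n%:R by rewrite (lt_le_trans (truncnS_gt M))// ler_nat leq_maxr.
have n0 : (0 < n)%N by exact: leq_trans (leq_maxr _ _).
have [t [ht [z tz]]] := traceM n Mn (fun=> point).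
pose T : finType := ('I_(2 * n) * 'I_n.+1)%type.
pose tau (p : T) := template f point p.1 p.2.
have cardT : #|{: T}|%:R <= expR (eta / 8 * n%:R) :> R.
  by rewrite card_prod !card_ord; apply: hn1; exact: leq_maxl.
have window i : exists p : T,
    (\sum_(j < n) (e / 8 < mdist (iter (i + j)%N f z) (tau p j))%R)%N%:R <= d * n%:R.
  have [|v [u h]] := window_template i n0 _ ht tz; first by lra.
  by exists (v, u); apply: le_trans h _; rewrite ler_wpM2r//; lra.
have [p0 _] := window 0%N.
(* Mismatches are counted at scale [e / 2] for [F] and [e / 8] for [V], so a closed set sits inside
   an open one that the traced orbit avoids. Two points within [e / 2] of a template are not
   [e]-separated. *)
pose F := [set w | forall p : T, d * n%:R < (mismatches f tau n (e / 4) p w)%:R].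
pose O (p : T) (j : 'I_n) := iter j f @^-1` [set v | (e / 8 < mdist v (tau p j))%R].
pose V := [set w | forall p : T, d * n%:R < (\sum_(j < n) (w \in O p j))%N%:R].
have oV : open V.
  rewrite openE => w Vw; apply: filter_forall => p.
  have oO j : open (O p j).
    apply: open_comp => [x _|]; [exact: continuous_iter|exact: open_mdist_gt].
  have := open_count_gt (d * n%:R) oO; rewrite openE; apply.
  exact: Vw.
have FV : F `<=` V.
  move=> w Fw p; apply: lt_le_trans (Fw p) _; rewrite ler_nat; apply: leq_sum => j _.
  case: (boolP (2 * (e / 4) <= _)) => // h.
  by rewrite mem_set// /O /=; apply: lt_le_trans h; lra.
have zV i : ~ V (iter i f z).
  have [p hp] := window i; move=> /(_ p); rewrite ltNge => /negP; apply.
  apply: le_trans hp; rewrite ler_nat; apply: leq_sum => j _.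
  rewrite addnC iterD; case: (boolP (_ \in O p j)) => // /set_mem.
  by rewrite /O /= => ->.
have cF : closed F by exact: closed_mismatches.
have [N0 hN0] := uniquely_ergodic_visits compactX continuous_f ue cF oV FV zV d0.
(* The part of the final exponent independent of [N]; the rest is at most [eta / 2 * N]. *)
pose c : R := n%:R * (1 + eta / 8 + 2 * s).
have [N2 hN2] : exists N2, forall N, (N2 <= N)%N -> c <= eta / 4 * N%:R.
  exists (Num.truncn (c / (eta / 4))).+1 => N h; rewrite mulrC.
  rewrite -ler_pdivrMr ?divr_gt0// (le_trans (ltW (truncnS_gt _)))//.
  by rewrite ler_nat.
exists (maxn N0 N2) => N; rewrite geq_max => /andP[N0N N2N].
apply: ge_ereal_sup => _ [E sepE <-]; rewrite lee_fin.
have hcell' x y : cell x = cell y -> mdist x y <= 4 * (e / 4).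
  by move/hcell; rewrite mulrC divfK.
have sepE' : bowen_separated f N (4 * (e / 4)) E.
  by rewrite mulrC divfK.
apply: le_trans (card_bowen_separated p0 n0 (ltW d0) d1 hcell'
  (fun y => hN0 N y N0N) sepE' s0) _.
set L := (N %/ n).+1.
have Ln : L%:R * n%:R <= N%:R + n%:R :> R.
  by rewrite -natrM -natrD ler_nat /L mulSnr leq_add2r leq_trunc_div.
have TL : #|{: T}|%:R ^+ L <= expR (eta / 8 * (N%:R + n%:R)) :> R.
  apply: (@le_trans _ _ (expR (eta / 8 * n%:R) ^+ L)).
    by rewrite lerXn2r ?nnegrE ?expR_ge0.
  by rewrite -expRM_natl ler_expR mulrCA ler_wpM2l// divr_ge0// ltW.
have nn : n%:R <= expR n%:R :> R.
  by apply: le_trans (expR_ge1Dx _); rewrite lerDr.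
apply: (@le_trans _ _ (expR n%:R * expR (eta / 8 * (N%:R + n%:R)) *
    expR (s * ((d + d) * N%:R + 2 * n%:R) + N%:R * (#|C|%:R * expR (- s))))).
  by rewrite ler_wpM2r ?expR_ge0// ler_pM// exprn_ge0.
rewrite -!expRD ler_expR.
have NC : N%:R * (#|C|%:R * expR (- s)) <= N%:R * (eta / 8).
  by rewrite ler_wpM2l.
have Nsd : s * d * N%:R <= eta / 8 * N%:R by rewrite ler_wpM2r.
have := hN2 N N2N; rewrite /c => hc.
have etaN : 0 <= eta * N%:R by rewrite mulr_ge0// ltW.
by lra.
Qed.

Lemma uniquely_ergodic_entropy_at_scale (e : R) :
  approximate_product_property f -> uniquely_ergodic f -> 0 < e ->
  entropy_at_scale f e = 0%E.
Proof.
move=> app_f ue e0; apply/eqP; rewrite eq_le; apply/andP; split; last first.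
  rewrite /entropy_at_scale limn_esup_lim; apply: lime_ge.
    exact: is_cvg_esups.
  apply: nearW => m.
  apply: (@le_trans _ _ ((m%:R^-1)%:E * lne (max_separated f m e))%E); last first.
    by apply: ereal_sup_ubound; exists m => //=.
  apply: mule_ge0; first by rewrite lee_fin invr_ge0.
  rewrite lne_ge0; apply: ereal_sup_ubound; exists [fset (point : X)]%fset => /=.
    by move=> x y /fset1P -> /fset1P ->; rewrite eqxx.
  by rewrite cardfs1.
apply/lee_addgt0Pr => eta eta0; rewrite add0e.
have [N0 hN0] := uniquely_ergodic_card_le app_f ue e0 eta0.
rewrite /entropy_at_scale limn_esup_lim; apply: lime_le.
  exact: is_cvg_esups.
near=> m; apply: ge_ereal_sup => _ [k /= mk <-].
have m0 : (0 < m)%N by near: m; exact: nbhs_infty_gt.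
have N0m : (N0 <= m)%N by near: m; exact: nbhs_infty_ge.
have k0 : 0 < k%:R :> R by rewrite ltr0n (leq_trans m0).
apply: (@le_trans _ _ ((k%:R^-1)%:E * lne (expR (eta * k%:R))%:E)%E).
  apply: lee_wpmul2l; first by rewrite lee_fin invr_ge0.
  rewrite lee_lne ?hN0 ?(leq_trans N0m)//.
    by rewrite in_itv/= leey max_separated_ge0.
  by rewrite in_itv/= leey lee_fin expR_ge0.
by rewrite lne_EFin ?expR_gt0// expRK -EFinM lee_fin mulrCA mulVf ?mulr1// gt_eqF.
Unshelve. all: by end_near. Qed.

End unique_ergodicity_entropy.

Theorem theorem1p2 (R : realType) (X : pmetricType R) (f : X -> X)
    (compactX : compact [set: X]) (continuous_f : continuous f)
    (app_f : approximate_product_property f) :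
  uniquely_ergodic f <-> topological_entropy f = 0%E.
Proof.
split=> [ue|h0].
  apply: cvg_lim => //; apply: cvg_near_cst.
  by near=> e; apply: uniquely_ergodic_entropy_at_scale.
(* Existence needs no entropy assumption: the empirical measures of a single orbit, over lengths
   [i + 1], suffice. *)
have [mu imu _] := krylov_bogolyubov (R := R) (fun=> point) compactX continuous_f ltnSn.
by exists mu => // nu inu; exact: entropy0_unique.
Unshelve. all: by end_near. Qed.
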